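(* Let $\Psi=(X^*,\Phi,X_*,\Phi^\vee)$ be a (not necessarily reduced) root datum, and let $\Gamma$ be a finite group of automorphisms of $\Psi$ such that there exists a $\Gamma$-stable set $\Delta$ of simple roots in $\Phi$. Then, with $\bar X^*,\bar\Phi,\bar X_*,\bar\Phi^\vee$ and the pairing between $\bar X^*$ and $\bar X_*$ as defined in the context, $$\bar\Psi:=(\bar X^*,\bar\Phi,\bar X_*,\bar\Phi^\vee)$$ is a root datum.
   Context: Let $V^*=X^*\otimes\mathbb{Q}$ and let $i^*\colon V^*\to\bar V^*:=V^*_\Gamma$ be the quotient map to the space of $\Gamma$-coinvariants. Let $\iota\colon\bar V^*\to V^*$ be the embedding, with image $(V^* )^{\Gamma}$, given by $\iota(\bar v)=\frac1{|\Gamma|}\sum_{\gamma\in\Gamma}\gamma v$, where $v\in V^*$ is any preimage of $\bar v$. Let $\bar X^*=i^*(X^* )$ and $\bar\Phi=i^*(\Phi)$ be the images of $X^*$ and $\Phi$; $\bar X^*$ is the module of $\Gamma$-coinvariants of $X^*$ modulo torsion. Let $\bar X_*=X_*^\Gamma$ with inclusion $i_*\colon\bar X_*\to X_*$. The groups $\bar X^*$ and $\bar X_*$ are paired by $\langle\bar x,\bar\lambda\rangle:=\langle\iota\bar x,i_*\bar\lambda\rangle$. For $\beta\in\Phi$ define a $\Gamma$-orbit $\Xi_\beta$ in $\Phi$ as follows. If $\Gamma\cdot\beta$ is an orthogonal set, let $\Xi_\beta=\Gamma\cdot\beta$. Otherwise, for each $\theta\in\Gamma\cdot\beta$ there exists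 a unique root $\theta'\neq\theta$ in $\Gamma\cdot\beta$ such that $\theta$ and $\theta'$ are not orthogonal; moreover $\theta+\theta'$ is a root in $\Phi$ not belonging to $\Gamma\cdot\beta$; in this case let $\Xi_\beta=\{\theta+\theta'\mid\theta\in\Gamma\cdot\beta\}$. For $\alpha\in\bar\Phi$ define $$\alpha^\vee=\frac{|\Gamma\cdot\beta|}{|\Xi_\beta|}\sum_{\xi\in\Xi_\beta}\xi^\vee\in\bar X_*,$$ where $\beta\in\Phi$ is any root with $i^*\beta=\alpha$ (the result does not depend on the choice of $\beta$, and $|\Gamma\cdot\beta|/|\Xi_\beta|\in\{1,2\}$). Let $\bar\Phi^\vee=\{\alpha^\vee\mid\alpha\in\bar\Phi\}$. *)

(* Defs.v *)
From HB Require Import structures.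
From mathcomp Require Import fingroup all_boot all_order all_algebra.
From mathcomp Require Import ring finmap boolp.

Set Implicit Arguments.
Unset Strict Implicit.
Unset Printing Implicit Defensive.

Import Order.TTheory GRing.Theory Num.Theory.

Local Open Scope fset_scope.
Local Open Scope ring_scope.
Local Open Scope quotient_scope.

(* X (x) Q, realized as the localization of X at the nonzero integers: the    *)
(* pair (x, n) stands for the fraction x / (n + 1).                           *)
Section TensQ.
Variable X : zmodType.
Implicit Types (x y : X) (p q : X * nat) (a b : rat).

Definition frac_eq p q : bool :=
  `[< exists2 k, (0 < k)%N & p.1 *+ q.2.+1 *+ k = q.1 *+ p.2.+1 *+ k >].

Lemma frac_eqP : equiv_class_of frac_eq.
Proof.
split=> [p|p q|q p r].
- by apply/asboolP; exists 1%N.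
- by apply/asboolP/asboolP => -[k k0 e]; exists k.
- move=> /asboolP[k k0 e] /asboolP[l l0 f]; apply/asboolP.
  exists (q.2.+1 * k * l)%N; first by rewrite !muln_gt0 k0.
  have -> : p.1 *+ r.2.+1 *+ (q.2.+1 * k * l)
          = p.1 *+ q.2.+1 *+ k *+ (r.2.+1 * l).
    by rewrite -!mulrnA; congr (_ *+ _); ring.
  have -> : r.1 *+ p.2.+1 *+ (q.2.+1 * k * l)
          = r.1 *+ q.2.+1 *+ l *+ (p.2.+1 * k).
    by rewrite -!mulrnA; congr (_ *+ _); ring.
  by rewrite e -f -!mulrnA; congr (_ *+ _); ring.
Qed.

Canonical frac_equiv := EquivRelPack frac_eqP.
Canonical frac_encModRel := defaultEncModRel frac_eq.

Definition tensQ := {eq_quot frac_eq}.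
HB.instance Definition _ := Choice.on tensQ.

Definition frac x n : tensQ := \pi_({eq_quot frac_eq}) (x, n).

Lemma eq_frac x y m n : frac x m = frac y n <->
  exists2 k, (0 < k)%N & x *+ n.+1 *+ k = y *+ m.+1 *+ k.
Proof.
split=> [/eqmodP/asboolP//|h].
by apply/eqmodP/asboolP.
Qed.

Lemma frac_repr (u : tensQ) : frac (repr u).1 (repr u).2 = u.
Proof. by rewrite /frac -surjective_pairing; exact: reprK. Qed.

Lemma tensQW (P : tensQ -> Prop) : (forall x n, P (frac x n)) -> forall u, P u.
Proof. by move=> h u; rewrite -[u]frac_repr. Qed.

Definition tensQ_add (u v : tensQ) : tensQ :=
  frac ((repr u).1 *+ (repr v).2.+1 + (repr v).1 *+ (repr u).2.+1)
       ((repr u).2.+1 * (repr v).2.+1).-1.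
Definition tensQ_opp (u : tensQ) : tensQ := frac (- (repr u).1) (repr u).2.
Definition tensQ_scale a (u : tensQ) : tensQ :=
  frac ((repr u).1 *~ numq a) (`|denq a|%N * (repr u).2.+1).-1.

Let pm m n : (m.+1 * n.+1).-1.+1 = (m.+1 * n.+1)%N.
Proof. by []. Qed.

Lemma tensQ_addE x y m n : tensQ_add (frac x m) (frac y n) =
  frac (x *+ n.+1 + y *+ m.+1) (m.+1 * n.+1).-1.
Proof.
have /eq_frac := frac_repr (frac x m); have /eq_frac := frac_repr (frac y n).
rewrite /tensQ_add.
case: (repr (frac x m)) => x' m'; case: (repr (frac y n)) => y' n' /=.
move=> [l l0 f] [k k0 e]; apply/eq_frac.
exists (k * l)%N; first by rewrite muln_gt0 k0.
rewrite !pm !mulrnDl; congr (_ + _).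
  transitivity (x' *+ m.+1 *+ k *+ (n'.+1 * n.+1 * l)); last rewrite e;
  by rewrite -!mulrnA; congr (_ *+ _); ring.
transitivity (y' *+ n.+1 *+ l *+ (m'.+1 * m.+1 * k)); last rewrite f;
by rewrite -!mulrnA; congr (_ *+ _); ring.
Qed.

Lemma tensQ_oppE x m : tensQ_opp (frac x m) = frac (- x) m.
Proof.
have /eq_frac := frac_repr (frac x m); rewrite /tensQ_opp.
case: (repr (frac x m)) => x' m' /= [k k0 e]; apply/eq_frac; exists k => //.
by rewrite !mulNrn e.
Qed.

Let denS a : exists d, `|denq a|%N = d.+1.
Proof. by exists `|denq a|%N.-1; rewrite prednK // absz_gt0 denq_neq0. Qed.

Lemma tensQ_scaleE a x m : tensQ_scale a (frac x m) =
  frac (x *~ numq a) (`|denq a|%N * m.+1).-1.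
Proof.
have /eq_frac := frac_repr (frac x m); rewrite /tensQ_scale.
case: (repr (frac x m)) => x' m' /= [k k0 e]; apply/eq_frac; exists k => //.
have [d ->] := denS a; rewrite !pm !pmulrn -!mulrzA.
have /(congr1 (fun z => z *~ (numq a * d.+1%:Z))) := e.
rewrite !pmulrn -!mulrzA => h.
transitivity (x' *~ (m.+1%:Z * (k%:Z * (numq a * d.+1%:Z)))).
  by congr (_ *~ _); rewrite PoszM; ring.
by rewrite h; congr (_ *~ _); rewrite PoszM; ring.
Qed.

Lemma tensQ_addA : associative tensQ_add.
Proof.
elim/tensQW=> x m; elim/tensQW=> y n; elim/tensQW=> z o.
rewrite !tensQ_addE !pm mulnA; congr frac.
by rewrite !mulrnDl -!mulrnA addrA; congr (_ *+ _ + _ *+ _ + _ *+ _); ring.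
Qed.

Lemma tensQ_addC : commutative tensQ_add.
Proof.
elim/tensQW=> x m; elim/tensQW=> y n.
by rewrite !tensQ_addE addrC mulnC.
Qed.

Lemma tensQ_add0 : left_id (frac 0 0) tensQ_add.
Proof.
elim/tensQW=> x m; rewrite tensQ_addE mul0rn add0r mul1n.
by apply/eq_frac; exists 1%N.
Qed.

Lemma tensQ_addN : left_inverse (frac 0 0) tensQ_opp tensQ_add.
Proof.
elim/tensQW=> x m; rewrite tensQ_oppE tensQ_addE mulNrn addNr.
by apply/eq_frac; exists 1%N => //; rewrite !mul0rn.
Qed.

HB.instance Definition _ := GRing.isZmodule.Build tensQ
  tensQ_addA tensQ_addC tensQ_add0 tensQ_addN.

Lemma fracD x y m n : frac x m + frac y n =
  frac (x *+ n.+1 + y *+ m.+1) (m.+1 * n.+1).-1.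
Proof. exact: tensQ_addE. Qed.

Lemma tensQ_scaleA a b u :
  tensQ_scale a (tensQ_scale b u) = tensQ_scale (a * b) u.
Proof.
elim/tensQW: u => x m; rewrite !tensQ_scaleE.
have [d ea] := denS a; have [e eb] := denS b; have [f eab] := denS (a * b).
rewrite ea eb eab !pm; apply/eq_frac; exists 1%N => //.
rewrite !pm !pmulrn -!mulrzA; congr (_ *~ _).
have E : numq a * numq b * f.+1 = numq (a * b) * (d.+1 * e.+1)%N.
  apply: (@intr_inj rat); rewrite !rmorphM /= !numqE.
  have D c g : `|denq c|%N = g.+1 -> (denq c)%:~R = (Posz g.+1)%:~R :> rat.
    by move=> <-; rewrite absz_denq.
  by rewrite (D _ _ ea) (D _ _ eb) (D _ _ eab) PoszM rmorphM /=; ring.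
rewrite mulr1 !PoszM; transitivity (numq a * numq b * f.+1 * m.+1); first by ring.
by rewrite E !PoszM; ring.
Qed.

Lemma tensQ_scale1 : left_id 1 tensQ_scale.
Proof.
elim/tensQW=> x m; rewrite tensQ_scaleE.
by apply/eq_frac; exists 1%N => //; rewrite mul1n.
Qed.

Lemma tensQ_scaleDr : right_distributive tensQ_scale +%R.
Proof.
move=> a; elim/tensQW=> x m; elim/tensQW=> y n.
rewrite fracD !tensQ_scaleE fracD.
have [d ->] := denS a; rewrite !pm; apply/eq_frac; exists 1%N => //.
rewrite !pm !pmulrn -!mulrzA !mulrzDl -!mulrzA.
by congr (_ *~ _ + _ *~ _); rewrite !PoszM; ring.
Qed.

Lemma tensQ_scaleDl u : {morph tensQ_scale^~ u : a b / a + b}.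
Proof.
move=> a b; elim/tensQW: u => x m; rewrite !tensQ_scaleE.
have [d ea] := denS a; have [e eb] := denS b; have [f eab] := denS (a + b).
rewrite ea eb eab fracD; apply/eq_frac; exists 1%N => //.
rewrite !pm !pmulrn -!mulrzA -mulrzDr -!mulrzA; congr (_ *~ _).
have E : numq (a + b) * (d.+1 * e.+1)%N = (numq a * e.+1 + numq b * d.+1) * f.+1.
  apply: (@intr_inj rat); rewrite !rmorphM rmorphD !rmorphM /= !numqE.
  have D c g : `|denq c|%N = g.+1 -> (denq c)%:~R = (Posz g.+1)%:~R :> rat.
    by move=> <-; rewrite absz_denq.
  by rewrite (D _ _ ea) (D _ _ eb) (D _ _ eab) PoszM rmorphM /=; ring.
rewrite mulr1 !PoszM.
transitivity (numq (a + b) * (d.+1 * e.+1)%N * m.+1 * m.+1).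
  by rewrite !PoszM; ring.
by rewrite E; ring.
Qed.

HB.instance Definition _ := GRing.Zmodule_isLmodule.Build rat tensQ
  tensQ_scaleA tensQ_scale1 tensQ_scaleDr tensQ_scaleDl.

End TensQ.

Definition toQ (X : zmodType) (x : X) : tensQ X := frac x 0.

Section ToQ.
Variable X : zmodType.

Fact toQ_zmod : zmod_morphism (@toQ X).
Proof.
move=> x y; apply: (addIr (toQ y)); rewrite subrK fracD.
by apply/eq_frac; exists 1%N => //; rewrite !mulr1n subrK.
Qed.
HB.instance Definition _ := GRing.isZmodMorphism.Build X (tensQ X) (@toQ X)
  toQ_zmod.
End ToQ.

Section TensQMap.
Variables (X Y : zmodType) (f : {additive X -> Y}).

Definition tensQ_map (u : tensQ X) : tensQ Y := frac (f (repr u).1) (repr u).2.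

Lemma tensQ_mapE x n : tensQ_map (frac x n) = frac (f x) n.
Proof.
have /eq_frac := frac_repr (frac x n); rewrite /tensQ_map.
case: (repr (frac x n)) => x' n' /= [k k0 /(congr1 f)].
by rewrite !raddfMn => e; apply/eq_frac; exists k.
Qed.

Fact tensQ_map_linear : linear tensQ_map.
Proof.
move=> a u v; elim/tensQW: u => x m; elim/tensQW: v => y n.
rewrite [a *: _]tensQ_scaleE fracD !tensQ_mapE.
by rewrite [a *: _]tensQ_scaleE fracD raddfD !raddfMn raddfMz.
Qed.
HB.instance Definition _ := GRing.isLinear.Build rat (tensQ X) (tensQ Y) *:%R
  tensQ_map tensQ_map_linear.

End TensQMap.

(* The Q-linear extension to X (x) Q of an additive f : X -> Z.               *)
Definition tensQ_eval (X : zmodType) (f : X -> int) (u : tensQ X) : rat :=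
  (f (repr u).1)%:~R / (repr u).2.+1%:R.

Lemma tensQ_evalE (X : zmodType) (f : {additive X -> int}) x n :
  tensQ_eval f (frac x n) = (f x)%:~R / n.+1%:R.
Proof.
have /eq_frac := frac_repr (frac x n); rewrite /tensQ_eval.
case: (repr (frac x n)) => x' n' /= [k k0 /(congr1 f)].
rewrite !raddfMn => /pmulrnI -/(_ k0) /(congr1 (fun z : int => z%:~R : rat)).
rewrite !rmorphMn /= => e.
apply/eqP; rewrite eqr_div ?pnatr_eq0//.
by rewrite [X in X == _]mulr_natr [X in _ == X]mulr_natr e.
Qed.

Section QuotMod.
Variables (K : nzRingType) (V : lmodType K) (N : submodClosed V).

Let memN u : (- u \in N) = (u \in N).
Proof.
by apply/idP/idP=> h; [rewrite -[u]opprK|]; rewrite -scaleN1r rpredZ.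
Qed.

Definition quotmod_eq (u v : V) : bool := u - v \in N.

Lemma quotmod_eqP : equiv_class_of quotmod_eq.
Proof.
split=> [u|u v|v u w]; rewrite /quotmod_eq.
- by rewrite subrr rpred0.
- by rewrite -opprB memN.
- by move=> uv vw; rewrite -(subrKA v) rpredD.
Qed.

Canonical quotmod_equiv := EquivRelPack quotmod_eqP.
Canonical quotmod_encModRel := defaultEncModRel quotmod_eq.

Definition quotmod := {eq_quot quotmod_eq}.
HB.instance Definition _ := Choice.on quotmod.

Definition toquot (v : V) : quotmod := \pi_({eq_quot quotmod_eq}) v.

Lemma toquotP u v : toquot u = toquot v <-> u - v \in N.
Proof. by split=> [/eqmodP|h] //; apply/eqmodP. Qed.

Lemma toquotK (u : quotmod) : toquot (repr u) = u.
Proof. exact: reprK. Qed.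

Lemma repr_toquot v : repr (toquot v) - v \in N.
Proof. by apply/toquotP; rewrite toquotK. Qed.

Definition quotmod_add (u v : quotmod) := toquot (repr u + repr v).
Definition quotmod_opp (u : quotmod) := toquot (- repr u).
Definition quotmod_scale a (u : quotmod) := toquot (a *: repr u).

Lemma quotmod_addE u v : quotmod_add (toquot u) (toquot v) = toquot (u + v).
Proof. by apply/toquotP; rewrite opprD addrACA rpredD ?repr_toquot. Qed.

Lemma quotmod_oppE u : quotmod_opp (toquot u) = toquot (- u).
Proof. by apply/toquotP; rewrite -opprD memN repr_toquot. Qed.

Lemma quotmod_scaleE a u : quotmod_scale a (toquot u) = toquot (a *: u).
Proof. by apply/toquotP; rewrite -scalerBr rpredZ ?repr_toquot. Qed.

Lemma quotmodW (P : quotmod -> Prop) :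
  (forall v, P (toquot v)) -> forall u, P u.
Proof. by move=> h u; rewrite -[u]toquotK. Qed.

Fact quotmod_addA : associative quotmod_add.
Proof.
by do 3!elim/quotmodW=> ?; rewrite !quotmod_addE addrA.
Qed.

Fact quotmod_addC : commutative quotmod_add.
Proof. by do 2!elim/quotmodW=> ?; rewrite !quotmod_addE addrC. Qed.

Fact quotmod_add0 : left_id (toquot 0) quotmod_add.
Proof. by elim/quotmodW=> ?; rewrite !quotmod_addE add0r. Qed.

Fact quotmod_addN : left_inverse (toquot 0) quotmod_opp quotmod_add.
Proof.
by elim/quotmodW=> ?; rewrite !quotmod_oppE !quotmod_addE addNr.
Qed.

HB.instance Definition _ := GRing.isZmodule.Build quotmod
  quotmod_addA quotmod_addC quotmod_add0 quotmod_addN.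

Fact quotmod_scaleA a b u :
  quotmod_scale a (quotmod_scale b u) = quotmod_scale (a * b) u.
Proof. by elim/quotmodW: u => ?; rewrite !quotmod_scaleE scalerA. Qed.

Fact quotmod_scale1 : left_id 1 quotmod_scale.
Proof. by elim/quotmodW=> ?; rewrite quotmod_scaleE scale1r. Qed.

Fact quotmod_scaleDr : right_distributive quotmod_scale +%R.
Proof.
move=> a; do 2!elim/quotmodW=> ?.
by rewrite [_ + _]quotmod_addE !quotmod_scaleE [RHS]quotmod_addE scalerDr.
Qed.

Fact quotmod_scaleDl u : {morph quotmod_scale^~ u : a b / a + b}.
Proof.
move=> a b; elim/quotmodW: u => ?.
by rewrite !quotmod_scaleE [RHS]quotmod_addE scalerDl.
Qed.

HB.instance Definition _ := GRing.Zmodule_isLmodule.Build K quotmod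
  quotmod_scaleA quotmod_scale1 quotmod_scaleDr quotmod_scaleDl.

Fact toquot_linear : linear toquot.
Proof.
by move=> a u v; rewrite -quotmod_addE -quotmod_scaleE.
Qed.
HB.instance Definition _ := GRing.isLinear.Build K V quotmod *:%R toquot
  toquot_linear.

End QuotMod.

Section Coinvariants.
Variables (gT : finGroupType) (V : lmodType rat) (act : gT -> {linear V -> V}).

(* The span of the g v - v, the kernel of V -> V_Gamma.                       *)
Definition augmentation (v : V) : bool :=
  `[< exists w : gT -> V, v = \sum_g (act g (w g) - w g) >].

Fact augmentation_submod : submod_closed augmentation.
Proof.
split=> [|a u v /asboolP[w ->] /asboolP[z ->]]; apply/asboolP.
  by exists (fun=> 0); rewrite big1// => g _; rewrite linear0 subrr.
exists (fun g => a *: w g + z g); rewrite scaler_sumr -big_split /=.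
by apply: eq_bigr => g _; rewrite linearP scalerBr opprD addrACA.
Qed.
HB.instance Definition _ := GRing.isSubmodClosed.Build rat V augmentation
  augmentation_submod.

Definition augmentation_sub : submodClosed V :=
  GRing.SubmodClosed.clone rat V augmentation _.

Definition coinvariants := quotmod augmentation_sub.
HB.instance Definition _ := GRing.Lmodule.on coinvariants.

Definition coinv (v : V) : coinvariants := toquot augmentation_sub v.

(* On the class of v this is the average of the g v, for any preimage v.      *)
Definition coinv_emb (u : coinvariants) : V :=
  #|gT|%:R^-1 *: \sum_g act g (repr u).

Lemma coinv_embE (actM : forall g h v, act (g * h)%g v = act g (act h v)) v :
  coinv_emb (coinv v) = #|gT|%:R^-1 *: \sum_g act g v.
Proof.
congr (_ *: _); have /asboolP[w e] := repr_toquot augmentation_sub v.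
apply/eqP; rewrite -subr_eq0 -sumrB.
under eq_bigr do rewrite -linearB.
rewrite e; under eq_bigr do rewrite linear_sum.
rewrite exchange_big big1// => h _ /=.
under eq_bigr do rewrite linearB.
rewrite sumrB [X in _ - X](reindex_inj (mulIg h)) /=.
by rewrite -sumrB big1// => g _; rewrite actM subrr.
Qed.

End Coinvariants.

Section Bar.
Variables (X Y : zmodType) (gT : finGroupType).
Variables (act : gT -> {additive X -> X}) (actv : gT -> {additive Y -> Y}).

Definition actQ g : {linear tensQ X -> tensQ X} := tensQ_map (act g).

Definition istarQ (x : X) : coinvariants actQ := coinv actQ (toQ x).

Definition istar_range (u : coinvariants actQ) : bool :=
  `[< exists x, istarQ x = u >].

Fact istar_range_zmod : zmod_closed istar_range.
Proof.
split=> [|_ _ /asboolP[x <-] /asboolP[y <-]]; apply/asboolP.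
  by exists 0; rewrite /istarQ raddf0 /coinv linear0.
by exists (x - y); rewrite /istarQ raddfB /coinv linearB.
Qed.
HB.instance Definition _ := GRing.isZmodClosed.Build (coinvariants actQ)
  istar_range istar_range_zmod.

Definition barX := {u : coinvariants actQ | u \in istar_range}.
HB.instance Definition _ := SubType.on barX.
HB.instance Definition _ := Choice.on barX.
HB.instance Definition _ := [SubChoice_isSubZmodule of barX by <:].

Fact istar_subproof x : istarQ x \in istar_range.
Proof. by apply/asboolP; exists x. Qed.
Definition istar (x : X) : barX := exist _ (istarQ x) (istar_subproof x).

Definition invariant (y : Y) : bool := [forall g, actv g y == y].

Fact invariant_zmod : zmod_closed invariant.
Proof.
split=> [|x y /forallP hx /forallP hy]; apply/forallP=> g.
  by rewrite raddf0.
by rewrite raddfB (eqP (hx g)) (eqP (hy g)).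
Qed.
HB.instance Definition _ := GRing.isZmodClosed.Build Y invariant invariant_zmod.

Definition barY := {y : Y | y \in invariant}.
HB.instance Definition _ := SubType.on barY.
HB.instance Definition _ := Choice.on barY.
HB.instance Definition _ := [SubChoice_isSubZmodule of barY by <:].

End Bar.

Section RootDatum.
Variables (X Y : zmodType) (pairing : X -> Y -> int).
Variables (Phi : {fset X}) (Phiv : {fset Y}) (coroot : X -> Y).

Definition free_of_finite_rank (Z : zmodType) : Prop :=
  exists n (e : 'I_n -> Z),
    forall z, exists! c : {ffun 'I_n -> int}, z = \sum_i e i *~ c i.

Record perfect_pairing : Prop := PerfectPairing {
  pairDl : forall y, {morph pairing^~ y : x x' / x + x'};
  pairDr : forall x, {morph pairing x : y y' / y + y'};
  pair_perfectl : forall f : {additive Y -> int},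
    exists! x, forall y, pairing x y = f y;
  pair_perfectr : forall f : {additive X -> int},
    exists! y, forall x, pairing x y = f x
}.

(* The bijection Phi -> Phiv, a |-> a^vee, is given by a total function       *)
(* whose values outside Phi are irrelevant.                                   *)
Record is_root_datum : Prop := IsRootDatum {
  rd_freeX : free_of_finite_rank X;
  rd_freeY : free_of_finite_rank Y;
  rd_perfect : perfect_pairing;
  rd_coroot_inj : {in Phi &, injective coroot};
  rd_coroot_im : [fset coroot a | a in Phi] = Phiv;
  rd_pair2 : {in Phi, forall a, pairing a (coroot a) = 2};
  rd_refl : {in Phi, forall a,
    [fset x - a *~ pairing x (coroot a) | x in Phi] = Phi};
  rd_corefl : {in Phi, forall a,
    [fset y - coroot a *~ pairing a y | y in Phiv] = Phiv}
}.

Record is_rd_aut (f : X -> X) (fv : Y -> Y) : Prop := IsRdAut {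
  aut_bij : bijective f;
  aut_bijv : bijective fv;
  aut_pair : forall x y, pairing (f x) (fv y) = pairing x y;
  aut_roots : [fset f a | a in Phi] = Phi;
  aut_coroot : {in Phi, forall a, coroot (f a) = fv (coroot a)}
}.

(* gT is identified with a group of automorphisms; actv is determined by act  *)
(* through the perfect pairing.                                               *)
Record is_aut_group (gT : finGroupType)
    (act : gT -> {additive X -> X}) (actv : gT -> {additive Y -> Y}) : Prop :=
  IsAutGroup {
  autg_aut : forall g, is_rd_aut (act g) (actv g);
  autg_mul : forall g h x, act (g * h)%g x = act g (act h x);
  autg_faithful : forall g h, act g =1 act h -> g = h
}.

Definition is_simple_roots (Delta : {fset X}) : Prop :=
  [/\ Delta `<=` Phi,
      forall c : X -> int, \sum_(d <- Delta) d *~ c d = 0 ->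
        {in Delta, forall d, c d = 0} &
      {in Phi, forall a, exists c : X -> nat,
        a = \sum_(d <- Delta) d *+ c d \/ a = - \sum_(d <- Delta) d *+ c d}].

Section Orbits.
Variables (gT : finGroupType) (act : gT -> {additive X -> X}).

Definition orbit_of (b : X) : {fset X} := [fset act g b | g in gT].

(* For roots a and b this is orthogonality for any Weyl-invariant form.      *)
Definition orth (a b : X) : bool := pairing a (coroot b) == 0.

Definition orthogonal_set (A : {fset X}) : bool :=
  all (fun a => all (fun b => (a == b) || orth a b) A) A.

Definition Xi (b : X) : {fset X} :=
  if orthogonal_set (orbit_of b) then orbit_of b
  else [fset t + t' | t in orbit_of b,
                      t' in [fset u in orbit_of b | (u != t) && ~~ orth t u]].

(* The division is exact: t |-> t + t' is an equivariant map from the orbit   *)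
(* of b onto Xi b, and the quotient is 1 or 2.                                *)
Definition bar_coroot_val (b : X) : Y :=
  (\sum_(x <- Xi b) coroot x) *+ (#|` orbit_of b| %/ #|` Xi b|).

End Orbits.

Section BarDatum.
Variables (gT : finGroupType).
Variables (act : gT -> {additive X -> X}) (actv : gT -> {additive Y -> Y}).

Definition barPhi : {fset barX act} := [fset istar act b | b in Phi].

(* The pairing <coinv_emb x, l> is computed in Q; p is its integer value.     *)
Definition is_bar_pairing (p : barX act -> barY actv -> int) : Prop :=
  forall x l, (p x l)%:~R = tensQ_eval (pairing^~ (val l)) (coinv_emb (val x)).

(* The formula is required for all roots b with the same image istar b.       *)
Definition is_bar_coroot (c : barX act -> barY actv) : Prop :=
  {in Phi, forall b, val (c (istar act b)) = bar_coroot_val act b}.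

End BarDatum.

End RootDatum.

(* Main.v *)
From HB Require Import structures.
Require Import Defs.
From mathcomp Require Import fingroup perm.
From mathcomp Require Import all_boot all_order all_algebra.
From mathcomp Require Import finmap boolp.
From mathcomp Require Import ring zify.

(* The form (x, y) = sum of <x, v><y, v> over the coroots v is invariant      *)
(* under reflections and Gamma and positive definite on the span of Phi, and  *)
(* 2 (x, b) = <x, b^vee> (b, b).  Because Delta is Gamma-stable, no root has  *)
(* trace 0, the trace of x being the sum of the g x.  So if t <> u are roots  *)
(* with the same trace then t - u is not a root, and (t, u) <= 0.  It follows *)
(* that the fibres of i^* on Phi are the Gamma-orbits.  For an orbit O with   *)
(* sum S, the integer q = <S, t^vee>, t in O, does not depend on t and is     *)
(* positive because (S, S) > 0; as <u, t^vee> is 0 or -1 for t <> u in O,     *)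
(* each t has at most one non-orthogonal partner t', and then                 *)
(* (t + t')^vee = t^vee + t'^vee.  The roots in Xi b are pairwise orthogonal, *)
(* so the product of their reflections acts on Phi, and it induces the        *)
(* reflection in i^* b on the coinvariants.  For the coroots one uses that    *)
(* the coroot of a is determined on the span of the roots by                  *)
(* <a, a^vee> = 2 and the stability of the root set.  The pairing is perfect  *)
(* because Y^Gamma is the kernel of an endomorphism of a free module, hence a *)
(* direct summand.                                                            *)

Set Implicit Arguments.
Unset Strict Implicit.
Unset Printing Implicit Defensive.

Import Order.TTheory GRing.Theory Num.Theory.

Local Open Scope fset_scope.
Local Open Scope ring_scope.

(** The proof works inside X, with [trace] in place of the projection to coinvariants: by [istar_eq]
    two elements have the same image exactly when their traces agree. No root has trace 0
    ([trace_root]), so roots of equal trace are conjugate ([trace_eq_orbit]), and an orbit is either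
    orthogonal or a union of mutually orthogonal pairs spanning an A_2 ([orbit_pairing], [adj_uniq],
    [adj_exists]). This gives the reflections of the folded roots ([bar_root_reflection]). The
    coroot axioms come from rigidity: a finite set in a torsion-free group contains no infinite
    progression, so a reflection preserving it is pinned down by its root or by its functional
    ([reflection_functional_uniq], [reflection_root_uniq]). Perfectness comes from [kernel_summand]
    through [bar_basis]. *)

Definition mk_additive (U V : zmodType) (f : U -> V) (fB : zmod_morphism f) :
    {additive U -> V} :=
  HB.pack f (GRing.isZmodMorphism.Build U V f fB).

Lemma sumr_const_fset (T : choiceType) (V : nmodType) (A : {fset T}) (v : V) :
  \sum_(x <- A) v = v *+ #|` A|.
Proof. by rewrite big_const_seq count_predT iter_addr_0. Qed.

Lemma bigD1_fset_cond (T : choiceType) (V : nmodType) (A : {fset T})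
    (P : pred T) (F : T -> V) a :
  a \in A -> P a ->
  \sum_(x <- A | P x) F x = F a + \sum_(x <- A | P x && (x != a)) F x.
Proof.
move=> aA Pa; rewrite -big_filter (bigD1_seq a) ?filter_uniq ?fset_uniq //=.
  by rewrite big_filter_cond.
by rewrite mem_filter Pa.
Qed.

Lemma bigD1_fset (T : choiceType) (V : nmodType) (A : {fset T}) (F : T -> V) a :
  a \in A ->
  \sum_(x <- A) F x = F a + \sum_(x <- A | x != a) F x.
Proof. by move=> aA; rewrite (bigD1_seq a) //= fset_uniq. Qed.

Lemma card_finGroup_gt0 (gT : finGroupType) : (0 < #|gT|)%N.
Proof. by apply/card_gt0P; exists 1%g. Qed.

(** * Torsion-freeness and finite sets *)

Definition torsion_free (Z : zmodType) : Prop :=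
  forall (z : Z) n, z *+ n.+1 = 0 -> z = 0.

Lemma free_torsion_free (Z : zmodType) :
  free_of_finite_rank Z -> torsion_free Z.
Proof.
move=> [n [e he]] z k zk0.
have [c [zE _]] := he z; have [c0 [_ c0U]] := he 0.
have c0E : c0 = [ffun=> 0].
  by apply: c0U; rewrite big1// => i _; rewrite ffunE mulr0z.
have : c0 = [ffun i => c i * k.+1%:Z].
  apply: c0U; rewrite -[LHS]zk0 [z in LHS]zE -sumrMnl; apply: eq_bigr => i _.
  by rewrite ffunE mulrzA pmulrn.
rewrite c0E => /ffunP ck; rewrite zE big1// => i _.
have := ck i; rewrite !ffunE => /esym/eqP; rewrite mulf_eq0 orbF => /eqP->.
by rewrite mulr0z.
Qed.

(** For d nonzero the terms would be pairwise distinct, too many for a finite set. *)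
Lemma fset_progression (Z : zmodType) (A : {fset Z}) (z d : Z) :
  torsion_free Z -> (forall k, z + d *+ k \in A) -> d = 0.
Proof.
move=> tfZ zdA; apply/eqP/negP => /negP d0.
have inj_zd : injective (fun k => z + d *+ k).
  suff le i j : (i <= j)%N -> z + d *+ i = z + d *+ j -> i = j.
    by move=> i j /= e; case: (leqP i j) => [|/ltnW] /le -> //.
  move=> ij /addrI/eqP; rewrite eq_sym -subr_eq0 -mulrnBr // => /eqP e.
  apply/eqP; rewrite eqn_leq ij /= -subn_eq0; apply/eqP.
  case: (j - i)%N e => // k /tfZ /eqP; by rewrite (negPf d0).
have := @uniq_leq_size _ [seq z + d *+ k | k <- iota 0 #|` A|.+1] (enum_fset A).
rewrite map_inj_uniq ?iota_uniq // size_map size_iota ltnn => /(_ isT) F.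
by suff: false by []; apply: F => _ /mapP[k _ ->]; exact: zdA.
Qed.

(** * Reflections *)

Section Reflections.
Variable Z : zmodType.
Implicit Types (a b x : Z) (f g : {additive Z -> int}) (A : {fset Z}).

Definition reflection a f x := x - a *~ f x.

Fact reflection_zmod a f : zmod_morphism (reflection a f).
Proof.
move=> x y; rewrite /reflection raddfB mulrzBr !opprB.
by rewrite [_ - a *~ f x]addrC addrACA [- y + _]addrC.
Qed.
HB.instance Definition _ a f :=
  GRing.isZmodMorphism.Build Z Z (reflection a f) (reflection_zmod a f).

Lemma reflectionN a f : f a = 2 -> reflection a f a = - a.
Proof. by rewrite /reflection => ->; rewrite opprD addNKr. Qed.

Lemma functional_reflection a f x : f a = 2 -> f (reflection a f x) = - f x.
Proof. by move=> fa; rewrite raddfB raddfMz fa mulrzz; ring. Qed.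

Lemma reflectionK a f : f a = 2 -> involutive (reflection a f).
Proof.
move=> fa x; rewrite {1}/reflection functional_reflection // mulrNz opprK.
by rewrite /reflection subrK.
Qed.

Lemma reflection_fset A a f : f a = 2 ->
  {in A, forall x, reflection a f x \in A} -> reflection a f @` A = A.
Proof.
move=> fa fA; apply/fsetP => x; apply/imfsetP/idP => [[y yA ->]|xA].
  exact: fA.
by exists (reflection a f x); [exact: fA|rewrite reflectionK].
Qed.

(* The product of the two reflections is the transvection                     *)
(* x |-> x + (f x - g x) a, which has infinite order on x unless f x = g x.   *)
Lemma reflection_functional_uniq A a f g : torsion_free Z ->
  f a = 2 -> g a = 2 ->
  {in A, forall x, reflection a f x \in A} ->
  {in A, forall x, reflection a g x \in A} -> {in A, f =1 g}.
Proof.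
move=> tfZ fa ga fA gA x xA.
pose d := a *~ (f x - g x).
have tA k : x + d *+ k \in A.
  elim: k => [|k IH]; first by rewrite addr0.
  suff -> : x + d *+ k.+1 = reflection a g (reflection a f (x + d *+ k)).
    by apply: gA; apply: fA.
  have fd : f d = g d by rewrite !raddfMz fa ga.
  have E y : reflection a g (reflection a f y) = y + a *~ (f y - g y).
    rewrite {1}/reflection raddfB raddfMz ga /reflection -addrA -opprD -mulrzDr.
    by congr (_ + _); rewrite -mulrNz; congr (_ *~ _); rewrite mulrzz; ring.
  rewrite E mulrSr addrA; congr (_ + _ *~ _).
  by rewrite !raddfD !raddfMn /= fd; ring.
have /eqP := fset_progression tfZ tA.
have tfa n : a *+ n.+1 != 0.
  by apply/eqP => /tfZ a0; move: fa; rewrite a0 raddf0.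
rewrite /d; move: (f x - g x) (subr_eq0 (f x) (g x)) => m.
case: (intP m) => [|n|n] mE.
- by move=> _; apply/eqP; rewrite -mE.
- by rewrite -pmulrn (negPf (tfa n)).
- by rewrite mulrNz oppr_eq0 -pmulrn (negPf (tfa n)).
Qed.

(** The product of the two reflections is x |-> x + (f x) (b - a). As f kills b - a, its iterates
    move a by multiples of 2 (b - a) inside A. *)
Lemma reflection_root_uniq A a b f : torsion_free Z ->
  f a = 2 -> f b = 2 -> a \in A ->
  {in A, forall x, reflection a f x \in A} ->
  {in A, forall x, reflection b f x \in A} -> a = b.
Proof.
move=> tfZ fa fb aA sA tA.
have E y : reflection b f (reflection a f y) = y + (b - a) *~ f y.
  rewrite {1}/reflection functional_reflection // mulrNz opprK.
  by rewrite mulrzBl /reflection -!addrA [- _ + _]addrC.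
have pA k : a + (b - a) *+ 2 *+ k \in A.
  elim: k => [|k IH]; first by rewrite addr0.
  suff -> : a + (b - a) *+ 2 *+ k.+1 =
    reflection b f (reflection a f (a + (b - a) *+ 2 *+ k)) by apply/tA/sA.
  by rewrite E raddfD !raddfMn raddfB fa fb subrr !mul0rn addr0 -addrA -mulrSr.
by have /tfZ/eqP := fset_progression tfZ pA; rewrite subr_eq0 => /eqP.
Qed.

(** * Integral spans *)

Definition int_span A (z : Z) : Prop :=
  exists c : Z -> int, z = \sum_(a <- A) a *~ c a.

Lemma int_span_mem A a : a \in A -> int_span A a.
Proof.
move=> aA; exists (fun x => (x == a)%:R).
rewrite (big_fsetD1 a) //= eqxx mulr1z big_seq big1 ?addr0// => x.
by rewrite !inE => /andP[/negPf-> _]; rewrite mulr0z.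
Qed.

Lemma int_spanB A x y : int_span A x -> int_span A y -> int_span A (x - y).
Proof.
move=> [c ->] [d ->]; exists (fun a => c a - d a).
by rewrite -sumrB; apply: eq_bigr => a _; rewrite mulrzBr.
Qed.

Lemma int_span0 A : int_span A 0.
Proof. by exists (fun=> 0); rewrite big1 // => a _; rewrite mulr0z. Qed.

Lemma int_spanD A x y : int_span A x -> int_span A y -> int_span A (x + y).
Proof.
move=> hx hy; rewrite -[y]opprK; apply: int_spanB => //.
by rewrite -sub0r; apply: int_spanB => //; exact: int_span0.
Qed.

Lemma int_spanMz A x n : int_span A x -> int_span A (x *~ n).
Proof.
move=> [c ->]; exists (fun a => c a * n).
rewrite mulrz_suml; apply: eq_bigr => a _; by rewrite mulrzA.
Qed.

Lemma int_span_sum (T : eqType) A (s : seq T) (F : T -> Z) :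
  {in s, forall t, int_span A (F t)} -> int_span A (\sum_(t <- s) F t).
Proof.
move=> h; rewrite big_seq; elim/big_ind: _ => //.
- exact: int_span0.
- by move=> *; apply: int_spanD.
Qed.

(* Averaging over a finite group containing the reflections fixes z but       *)
(* kills every root a, because the reflection in a maps a to - a.             *)
Lemma int_span_eq0 A (phi : Z -> {additive Z -> int}) (z : Z) :
  torsion_free Z ->
  {in A, forall a, phi a a = 2} ->
  {in A &, forall a x, reflection a (phi a) x \in A} ->
  int_span A z -> {in A, forall a, phi a z = 0} -> z = 0.
Proof.
move=> tfZ phi2 phiA [c zE] z0.
(* These are the permutations of A induced by additive endomorphisms fixing z. The reflections of A
   fix z because [phi b z = 0], so multiplying by them on the left preserves [W]. *)
pose W := [set s : {perm A} | `[< exists2 f : {additive Z -> Z},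
  (forall a : A, f (val a) = val (s a)) & f z = z >]]%SET.
pose sf (b a : A) : A := [` phiA _ _ (valP b) (valP a)]%fset.
have sf_inj (b : A) : injective (sf b).
  move=> x y /(congr1 val) /(inv_inj (reflectionK (phi2 _ (valP b)))).
  exact: val_inj.
pose sp (b : A) : {perm A} := perm (@sf_inj b).
have spW (b : A) s : s \in W -> (sp b * s)%g \in W.
  rewrite !inE => /asboolP[f fs fz]; apply/asboolP.
  exists (f \o reflection (val b) (phi (val b))) => [a|] /=.
    by rewrite permM permE -fs.
  by rewrite /reflection z0 ?(valP b) // mulr0z subr0.
have spK (b : A) : involutive (sp b).
  move=> a; apply: val_inj; rewrite !permE /=.
  exact: reflectionK (phi2 _ (valP b)) _.
have sp2 (b : A) : (sp b * sp b)%g = 1%g.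
  by apply/perm.permP => a; rewrite permM spK perm1.
have orb0 (b : A) : \sum_(s in W) val (s b) = 0.
  apply: (tfZ _ 1%N); rewrite mulr2n.
  (* One of the two copies of the sum is reindexed by [sp b], which turns b into - b and cancels the
     other copy. *)
  rewrite {1}(reindex_inj (mulgI (sp b))) /=.
  rewrite (eq_bigl (mem W)); last first.
    move=> s; apply/idP/idP => [/(spW b)|/spW//].
    by rewrite mulgA sp2 mul1g.
  rewrite -big_split big1 //= => s; rewrite inE => /asboolP[f fs _].
  rewrite permM -!fs permE /= reflectionN ?phi2 ?(valP b) //.
  by rewrite raddfN addNr.
have W1 : (0 < #|W|)%N.
  apply/card_gt0P; exists 1%g; rewrite inE; apply/asboolP.
  by exists idfun => // a; rewrite perm1.
have : z *+ #|W| = 0.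
  rewrite -sumr_const.
  transitivity (\sum_(s in W) \sum_(a : A) val (s a) *~ c (val a)).
    apply: eq_bigr => s; rewrite inE => /asboolP[f fs fz].
    rewrite -[LHS]fz zE raddf_sum big_seq_fsetE /=.
    by apply: eq_bigr => a _; rewrite raddfMz fs.
  rewrite exchange_big big1 //= => a _.
  by rewrite -mulrz_suml orb0 mul0rz.
by case: #|W| W1 => // n _ /tfZ.
Qed.

End Reflections.

(* Smith normal form M = L D R of the matrix of h: the kernel consists of the *)
(* y whose coordinates in the basis given by L^-1 vanish where D does not.    *)
Lemma kernel_summand (Y : zmodType) (h : {additive Y -> Y}) :
  free_of_finite_rank Y ->
  exists r (e : 'I_r -> Y) (c : 'I_r -> {additive Y -> int}),
    [/\ forall i, h (e i) = 0,
        forall i j, c i (e j) = (i == j)%:R &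
        forall y, h y = 0 -> y = \sum_i e i *~ c i y].
Proof.
move=> [n [e0 /choice[cd cdP]]].
pose vec (v : 'rV[int]_n) := \sum_i e0 i *~ v 0 i.
pose coord y : 'rV[int]_n := \row_i cd y i.
have coordK y : vec (coord y) = y.
  rewrite [RHS](cdP y).1; apply: eq_bigr => i _; by rewrite mxE.
have vecK v : coord (vec v) = v.
  apply/rowP => i; rewrite mxE.
  have -> : cd (vec v) = [ffun i => v 0 i]; last by rewrite ffunE.
  by apply: (cdP _).2; apply: eq_bigr => j _; rewrite ffunE.
have vecB : zmod_morphism vec.
  move=> u v; rewrite /vec -sumrB; apply: eq_bigr => i _.
  by rewrite !mxE mulrzBr.
have coordB : zmod_morphism coord.
  by move=> x y; rewrite -{1}[x]coordK -{1}[y]coordK -vecB vecK.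
pose C : {additive Y -> 'rV[int]_n} := mk_additive coordB.
pose M : 'M[int]_n := \matrix_i C (h (e0 i)).
have hM y : C (h y) = C y *m M.
  rewrite -{1}[y]coordK !raddf_sum mulmx_sum_row; apply: eq_bigr => i _.
  by rewrite !raddfMz rowK -scaler_int intz.
have [L Lu [R Ru [d _ ME]]] := int_Smith_normal_form M.
set D := \matrix_(_, _) _ in ME.
(* Entries past the end of the list [d] default to 0, so their indices belong to [I0] too. *)
pose I0 := [pred i : 'I_n | d`_i == 0].
have h0P y : reflect (forall i, i \notin I0 -> (C y *m L) 0 i = 0) (h y == 0).
  have -> : (h y == 0) = (C y *m L *m D == 0).
    rewrite -(can_eq (coordK : cancel C vec)) raddf0 hM ME !mulmxA.
    by rewrite -[RHS](can_eq (mulmxK Ru)) mul0mx.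
  have E i : (C y *m L *m D) 0 i = (C y *m L) 0 i * d`_i.
    rewrite mxE (bigD1 i) //= big1 ?addr0 => [|j ji].
      by rewrite !mxE eqxx mulr1n.
    by rewrite !mxE (val_eqE j i) (negPf ji) mulr0n mulr0.
  apply: (iffP eqP) => [/rowP CL0 i|CL0].
    have := CL0 i; rewrite E [RHS]mxE => /eqP; rewrite mulf_eq0 /=.
    by rewrite inE => /orP[/eqP|->].
  apply/rowP => i; rewrite E [RHS]mxE.
  by case: (boolP (i \in I0)) => [/eqP->|/CL0->]; rewrite ?mulr0 ?mul0r.
have cB i : zmod_morphism (fun y => (C y *m L) 0 i).
  by move=> x y; rewrite raddfB mulmxBl !mxE.
pose e (i : 'I_n) := vec (row i (invmx L)).
have ce i j : (C (e j) *m L) 0 i = (i == j)%:R.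
  by rewrite [C _]vecK -row_mul mulVmx // !mxE eq_sym.
exists #|I0|, (fun i => e (enum_val i)), (fun i => mk_additive (cB (enum_val i))).
split.
- move=> i; apply/eqP/h0P => j jI; rewrite ce.
  by case: eqVneq => // ji; move: jI; rewrite ji enum_valP.
- by move=> i j /=; rewrite /GRing.Additive.sort /= ce (inj_eq enum_val_inj).
- move=> y /eqP/h0P y0.
  transitivity (\sum_i e i *~ (C y *m L) 0 i).
    rewrite -[LHS]coordK -[coord y](mulmxK Lu) mulmx_sum_row.
    rewrite -[vec]/(mk_additive vecB : _ -> _) raddf_sum; apply: eq_bigr => i _.
    by rewrite -[X in X *: _]intz scaler_int raddfMz.
  rewrite (bigID (mem I0)) /= [X in _ + X]big1 ?addr0; last first.
    by move=> i /y0 ->; rewrite mulr0z.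
  exact: big_enum_val.
Qed.

(** * Perfect pairings *)

Section PerfectPairing.
Variables (U V : zmodType) (p : U -> V -> int).
Hypothesis pp : perfect_pairing p.

Fact left_pairing_zmod y : zmod_morphism (p^~ y).
Proof. by move=> x x'; rewrite -{2}[x](subrK x') (pairDl pp y (x - x')) addrK. Qed.
Definition left_pairing y := mk_additive (left_pairing_zmod y).

Fact right_pairing_zmod x : zmod_morphism (p x).
Proof. by move=> y y'; rewrite -{2}[y](subrK y') (pairDr pp x (y - y')) addrK. Qed.
Definition right_pairing x := mk_additive (right_pairing_zmod x).

Lemma pairing_injl x x' : p x =1 p x' -> x = x'.
Proof.
move=> e; have [z [_ zU]] := pair_perfectl pp (right_pairing x).
by rewrite -(zU x) // -(zU x') // => y; rewrite -e.
Qed.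

Lemma pairing_injr y y' : p^~ y =1 p^~ y' -> y = y'.
Proof.
move=> e; have [z [_ zU]] := pair_perfectr pp (left_pairing y).
by rewrite -(zU y) // -(zU y') // => x; rewrite -[p x y']e.
Qed.

Lemma pairing_reflection a v x y :
  p (reflection a (left_pairing v) x) y = p x (reflection v (right_pairing a) y).
Proof.
rewrite -[LHS]/(left_pairing y _) raddfB raddfMz.
rewrite -[RHS]/(right_pairing x _) [RHS]raddfB raddfMz !mulrzz.
by congr (_ - _); rewrite mulrC.
Qed.

(** Dual basis: perfectness represents each coordinate functional of V by some [x i]. *)
Lemma perfect_pairing_free : free_of_finite_rank V -> free_of_finite_rank U.
Proof.
move=> [n [e /choice[cd cdP]]].
have cdU y c : y = \sum_i e i *~ c i -> forall i, cd y i = c i.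
  move=> yE i; have -> : cd y = [ffun i => c i]; last by rewrite ffunE.
  by apply: (cdP y).2; rewrite [LHS]yE; apply: eq_bigr => j _; rewrite ffunE.
have cdB i : zmod_morphism (fun y => cd y i).
  move=> y z; apply: (cdU _ (fun i => cd y i - cd z i)).
  rewrite {1}(cdP y).1 {1}(cdP z).1 -sumrB.
  by apply: eq_bigr => j _; rewrite mulrzBr.
have /choice[x xP] : forall i, exists x, forall y, p x y = cd y i.
  move=> i; have [x [xE _]] := pair_perfectl pp (mk_additive (cdB i)).
  by exists x.
have cde i j : cd (e j) i = (j == i)%:R.
  apply: (cdU _ (fun i => (j == i)%:R)).
  rewrite (bigD1 j) //= eqxx mulr1z big1 ?addr0 // => k kj.
  by rewrite eq_sym (negPf kj) mulr0z.
exists n, x => z; exists [ffun i => p z (e i)]; split.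
  apply: pairing_injl => y.
  rewrite -[RHS]/(left_pairing y _) [RHS]raddf_sum [in LHS](cdP y).1.
  rewrite -[LHS]/(right_pairing z _) raddf_sum; apply: eq_bigr => i _.
  by rewrite !raddfMz ffunE -[left_pairing _ _]/(p _ _) xP !mulrzz mulrC.
move=> c zE; apply/ffunP => i; rewrite ffunE zE.
rewrite -[LHS]/(left_pairing (e i) _) raddf_sum (bigD1 i) //= big1 ?addr0.
  by rewrite -[LHS]/(left_pairing (e i) _) raddfMz -[left_pairing _ _]/(p _ _) xP
    cde eqxx mulrzz mul1r.
move=> j ji; rewrite -[LHS]/(left_pairing (e i) _) raddfMz.
rewrite -[left_pairing _ _]/(p _ _) xP cde eq_sym.
by rewrite (negPf ji) mul0rz.
Qed.

End PerfectPairing.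

(** * Root data and their automorphisms *)

Section RootDatumTheory.
Variables (X Y : zmodType) (pairing : X -> Y -> int).
Variables (Phi : {fset X}) (Phiv : {fset Y}) (coroot : X -> Y).
Hypothesis rdP : is_root_datum pairing Phi Phiv coroot.

Let tfX : torsion_free X := free_torsion_free (rd_freeX rdP).
Let tfY : torsion_free Y := free_torsion_free (rd_freeY rdP).

Lemma root_datum_perfect : perfect_pairing pairing.
Proof. exact: rd_perfect rdP. Qed.

Local Notation pairl := (left_pairing root_datum_perfect).
Local Notation pairr := (right_pairing root_datum_perfect).

Lemma pairlE y x : pairl y x = pairing x y. Proof. by []. Qed.
Lemma pairrE y x : pairr x y = pairing x y. Proof. by []. Qed.

Lemma coroot_Phiv a : a \in Phi -> coroot a \in Phiv.
Proof. by move=> aP; rewrite -(rd_coroot_im rdP) in_imfset. Qed.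

Lemma root_reflection a x : a \in Phi -> x \in Phi ->
  reflection a (pairl (coroot a)) x \in Phi.
Proof. by move=> aP xP; rewrite -(rd_refl rdP aP) in_imfset. Qed.

Lemma rootN a : a \in Phi -> - a \in Phi.
Proof.
move=> aP; rewrite -(@reflectionN _ a (pairl (coroot a))) ?root_reflection //.
exact: rd_pair2 rdP a aP.
Qed.

Lemma root_neq0 a : a \in Phi -> a != 0.
Proof.
move=> aP; apply/eqP => a0; have := rd_pair2 rdP aP.
by rewrite -pairlE a0 raddf0.
Qed.

(** The reflections are applied one at a time; by orthogonality, reflecting in one root leaves the
    coefficients at the others unchanged. *)
Lemma orthogonal_reflections (s : seq X) x :
  uniq s -> {subset s <= Phi} ->
  {in s &, forall a b, a != b -> pairing a (coroot b) = 0} ->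
  x \in Phi -> x - \sum_(a <- s) a *~ pairing x (coroot a) \in Phi.
Proof.
elim: s x => [|a s IH] x /=; first by rewrite big_nil subr0.
move=> /andP[as_ us] sP so xP.
have aP : a \in Phi by apply: sP; rewrite mem_head.
have sP' : {subset s <= Phi} by move=> b bs; apply: sP; rewrite inE bs orbT.
rewrite big_cons opprD addrA.
suff -> : \sum_(b <- s) b *~ pairing x (coroot b) =
    \sum_(b <- s) b *~ pairing (reflection a (pairl (coroot a)) x) (coroot b).
  apply: IH => //; last exact: root_reflection.
  by move=> b c bs cs; apply: so; rewrite inE ?bs ?cs orbT.
apply: eq_big_seq => b bs; congr (_ *~ _).
have ab : a != b by apply: contraNneq as_ => ->.
have {}so := so a b (mem_head _ _) (@mem_behead _ (a :: s) b bs) ab.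
by rewrite -[RHS]pairlE raddfB raddfMz !pairlE so mul0rz subr0.
Qed.

(** * The invariant form *)

Definition form x y := \sum_(v <- Phiv) pairing x v * pairing y v.

Lemma formC x y : form x y = form y x.
Proof. by apply: eq_bigr => v _; rewrite mulrC. Qed.

Fact form_zmod y : zmod_morphism (form^~ y).
Proof.
move=> x x'; rewrite -sumrB; apply: eq_bigr => v _.
by rewrite -!(pairlE v) raddfB mulrBl.
Qed.
Definition forml y := mk_additive (form_zmod y).
Lemma formlE y x : forml y x = form x y. Proof. by []. Qed.

Lemma formDl x x' y : form (x + x') y = form x y + form x' y.
Proof. exact: (raddfD (forml y)). Qed.
Lemma formDr x x' y : form y (x + x') = form y x + form y x'.
Proof. by rewrite ![form y _]formC formDl. Qed.
Lemma formNl x y : form (- x) y = - form x y.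
Proof. exact: (raddfN (forml y)). Qed.
Lemma formNr x y : form y (- x) = - form y x.
Proof. by rewrite ![form y _]formC formNl. Qed.

Lemma form_reflection a x y : a \in Phi ->
  form (reflection a (pairl (coroot a)) x) (reflection a (pairl (coroot a)) y)
  = form x y.
Proof.
move=> aP; rewrite /form -[in RHS](rd_corefl rdP aP) big_imfset /=; last first.
  move=> u v _ _.
  exact: (inv_inj (@reflectionK _ (coroot a) (pairr a) (rd_pair2 rdP aP))).
by apply: eq_bigr => v _; rewrite !(pairing_reflection root_datum_perfect).
Qed.

(** Invariance under the reflection in b gives (x - <x, b^vee> b, - b) = (x, b). *)
Lemma form_coroot b x : b \in Phi ->
  pairing x (coroot b) * form b b = 2 * form x b.
Proof.
move=> bP; have := form_reflection x b bP.
rewrite reflectionN ?pairlE ?(rd_pair2 rdP bP) // formNr -formlE raddfB raddfMz.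
by rewrite !formlE pairlE mulrzz; lia.
Qed.

Lemma form_ge0 x : 0 <= form x x.
Proof. by apply: sumr_ge0 => v _; rewrite -expr2 sqr_ge0. Qed.

(** A vanishing sum of squares means that every coroot kills x, and [int_span_eq0] applies. *)
Lemma form_eq0 x : int_span Phi x -> form x x = 0 -> x = 0.
Proof.
move=> xP /eqP; rewrite /form big_seq psumr_eq0 => [/allP x0|v _]; last first.
  by rewrite -expr2 sqr_ge0.
apply: (@int_span_eq0 _ Phi (fun a => pairl (coroot a))) => //.
- by move=> a aP; rewrite pairlE (rd_pair2 rdP).
- by move=> a b aP bP; exact: root_reflection.
- move=> a aP; rewrite pairlE; have := x0 _ (coroot_Phiv aP).
  by rewrite coroot_Phiv //= mulf_eq0 orbb => /eqP.
Qed.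

Lemma form_gt0 x : int_span Phi x -> x != 0 -> 0 < form x x.
Proof.
move=> xP x0; rewrite lt_neqAle form_ge0 andbT eq_sym.
by apply: contra_neq x0; exact: form_eq0.
Qed.

Lemma form_root_gt0 b : b \in Phi -> 0 < form b b.
Proof. by move=> bP; rewrite form_gt0 ?root_neq0 //; exact: int_span_mem. Qed.

Lemma pairing_gt0 b x : b \in Phi ->
  (0 < pairing x (coroot b)) = (0 < form x b).
Proof.
move=> bP; rewrite -(pmulr_lgt0 _ (form_root_gt0 bP)) form_coroot //.
by rewrite pmulr_rgt0.
Qed.

Lemma root_sub a b : a \in Phi -> b \in Phi -> a != b ->
  0 < pairing a (coroot b) -> a - b \in Phi.
Proof.
move=> aP bP ab p0.
have q0 : 0 < pairing b (coroot a) by rewrite pairing_gt0 // formC -pairing_gt0.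
have := root_reflection bP aP; have := root_reflection aP bP.
rewrite /reflection !pairlE.
(* A pairing equal to 1 exhibits a - b or b - a as a reflected root. *)
have [->|p1] := eqVneq (pairing a (coroot b)) 1; first by rewrite mulr1z.
have [-> /rootN|q1] := eqVneq (pairing b (coroot a)) 1.
  by rewrite mulr1z opprB.
(* With both pairings at least 2, (a, b) is at least (a, a) and (b, b), so (a - b, a - b) <= 0 and a
   = b. *)
move=> _ _; case/negP: ab; rewrite -subr_eq0; apply/eqP/form_eq0.
  by apply: int_spanB; exact: int_span_mem.
apply/eqP; rewrite eq_le form_ge0 andbT.
rewrite formDl !formDr !formNl !formNr [form b a]formC.
have := form_coroot a bP; have := form_coroot b aP; rewrite [form b a]formC.
by have := form_root_gt0 aP; have := form_root_gt0 bP; nia.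
Qed.

(** This is [int_span_eq0] for the coroots, with a root [r v] chosen for each coroot v. *)
Lemma coroot_span_eq0 y : int_span Phiv y ->
  {in Phi, forall a, pairing a y = 0} -> y = 0.
Proof.
move=> yP y0.
have rP v : exists a, v \in Phiv -> a \in Phi /\ coroot a = v.
  have [|vN] := boolP (v \in Phiv); last by exists 0.
  by rewrite -{1}(rd_coroot_im rdP) => /imfsetP[a aP ->]; exists a.
have [r {}rP] := choice rP.
apply: (@int_span_eq0 _ Phiv (fun v => pairr (r v))) => //.
- by move=> v /rP[aP {2}<-]; rewrite pairrE (rd_pair2 rdP).
- move=> v w /rP[aP e] wP; rewrite -(rd_corefl rdP aP) e.
  by apply/imfsetP; exists w.
- by move=> v /rP[aP _]; rewrite pairrE y0.
Qed.

(** * Automorphisms, traces and orbits *)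

Section Folding.
Variables (gT : finGroupType).
Variables (act : gT -> {additive X -> X}) (actv : gT -> {additive Y -> Y}).
Hypothesis autP : is_aut_group pairing Phi coroot act actv.

Lemma act_inj g : injective (act g).
Proof. exact: bij_inj (aut_bij (autg_aut autP g)). Qed.

Lemma act1 x : act 1%g x = x.
Proof. by apply: (@act_inj 1%g); rewrite -(autg_mul autP) mulg1. Qed.

Lemma actK g : cancel (act g) (act g^-1%g).
Proof. by move=> x; rewrite -(autg_mul autP) mulVg act1. Qed.

Lemma actVK g : cancel (act g^-1%g) (act g).
Proof. by move=> x; rewrite -(autg_mul autP) mulgV act1. Qed.

Lemma act_root g b : b \in Phi -> act g b \in Phi.
Proof. by move=> bP; rewrite -(aut_roots (autg_aut autP g)) in_imfset. Qed.

Lemma coroot_act g b : b \in Phi -> coroot (act g b) = actv g (coroot b).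
Proof. exact: (aut_coroot (autg_aut autP g)). Qed.

Lemma pair_act g x y : pairing (act g x) (actv g y) = pairing x y.
Proof. exact: (aut_pair (autg_aut autP g)). Qed.

Lemma pair_actv g x y : pairing x (actv g y) = pairing (act g^-1%g x) y.
Proof. by rewrite -{1}[x](actVK g) pair_act. Qed.

(** Multiplicativity is given for [act] and passes to [actv] through the pairing. *)
Lemma actvM g h y : actv (g * h)%g y = actv g (actv h y).
Proof.
apply: (pairing_injr root_datum_perfect) => x.
by rewrite !pair_actv invMg (autg_mul autP).
Qed.

Lemma actv_Phiv g : [fset actv g v | v in Phiv] = Phiv.
Proof.
apply/fsetP => v; rewrite -(rd_coroot_im rdP); apply/imfsetP/imfsetP.
  move=> [_ /imfsetP[a aP ->] ->]; exists (act g a); first exact: act_root.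
  by rewrite coroot_act.
move=> [a aP ->]; exists (coroot (act g^-1%g a)).
  by rewrite in_imfset // act_root.
by rewrite -coroot_act ?act_root // actVK.
Qed.

Lemma form_act g x y : form (act g x) (act g y) = form x y.
Proof.
rewrite /form -[in LHS](actv_Phiv g) big_imfset /=.
  by apply: eq_bigr => v _; rewrite !pair_act.
by move=> u v _ _; exact: (bij_inj (aut_bijv (autg_aut autP g))).
Qed.

Definition trace x := \sum_g act g x.

Fact trace_zmod : zmod_morphism trace.
Proof. by move=> x y; rewrite -sumrB; apply: eq_bigr => g _; rewrite raddfB. Qed.
HB.instance Definition _ := GRing.isZmodMorphism.Build X X trace trace_zmod.

Lemma trace_act g x : trace (act g x) = trace x.
Proof.
rewrite [RHS](reindex_inj (mulIg g)).
by apply: eq_bigr => h _; rewrite (autg_mul autP).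
Qed.

Lemma act_trace g x : act g (trace x) = trace x.
Proof.
rewrite [RHS](reindex_inj (mulgI g)) raddf_sum.
by apply: eq_bigr => h _; rewrite (autg_mul autP).
Qed.

Lemma form_trace x y : form (trace x) (trace y) = form (trace x) y *+ #|gT|.
Proof.
rewrite formC -formlE raddf_sum -sumr_const; apply: eq_bigr => g _.
by rewrite formlE formC -[in LHS](act_trace g) form_act.
Qed.

Lemma orbitP b x : reflect (exists g, x = act g b) (x \in orbit_of act b).
Proof.
by apply: (iffP (imfsetP _ _ _ _)) => [[g _ ->]|[g ->]]; exists g.
Qed.

Lemma orbit_refl b : b \in orbit_of act b.
Proof. by apply/orbitP; exists 1%g; rewrite act1. Qed.

Lemma orbit_act b g t : t \in orbit_of act b -> act g t \in orbit_of act b.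
Proof.
by move=> /orbitP[h ->]; apply/orbitP; exists (g * h)%g; rewrite (autg_mul autP).
Qed.

Lemma orbit_eq b t : t \in orbit_of act b -> orbit_of act t = orbit_of act b.
Proof.
move=> tb; apply/fsetP => u; apply/orbitP/idP => [[g ->]|]; first exact: orbit_act.
move: tb => /orbitP[g ->] /orbitP[h ->]; exists (h * g^-1)%g.
by rewrite (autg_mul autP) actK.
Qed.

Lemma orbit_trace b t : t \in orbit_of act b -> trace t = trace b.
Proof. by move=> /orbitP[g ->]; exact: trace_act. Qed.

Lemma orbit_form b t : t \in orbit_of act b -> form t t = form b b.
Proof. by move=> /orbitP[g ->]; exact: form_act. Qed.

Lemma orbit_root b t : b \in Phi -> t \in orbit_of act b -> t \in Phi.
Proof. by move=> bP /orbitP[g ->]; exact: act_root. Qed.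

Lemma orbit_image b g : [fset act g t | t in orbit_of act b] = orbit_of act b.
Proof.
apply/fsetP => t; apply/imfsetP/idP => [[u ub ->]|tb]; first exact: orbit_act.
by exists (act g^-1%g t); [exact: orbit_act|rewrite actVK].
Qed.

Lemma orth_act g t u : u \in Phi ->
  orth pairing coroot (act g t) (act g u) = orth pairing coroot t u.
Proof. by move=> uP; rewrite /orth coroot_act // pair_act. Qed.

Lemma Xi_act b g x : b \in Phi ->
  x \in Xi pairing coroot act b -> act g x \in Xi pairing coroot act b.
Proof.
move=> bP; rewrite /Xi; case: ifP => _; first exact: orbit_act.
move=> /imfset2P[t tO [u]]; rewrite !inE /= => /and3P[uO ut tu] ->.
apply/imfset2P; exists (act g t); first exact: orbit_act.
exists (act g u); last by rewrite raddfD.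
by rewrite !inE /= orbit_act //= (inj_eq (@act_inj g)) ut orth_act // (orbit_root bP).
Qed.

Lemma bar_coroot_val_orbit b t : t \in orbit_of act b ->
  bar_coroot_val pairing coroot act t = bar_coroot_val pairing coroot act b.
Proof. by move=> tb; rewrite /bar_coroot_val /Xi (orbit_eq tb). Qed.

Hypothesis simpleP : exists Delta : {fset X}, is_simple_roots Phi Delta /\
  forall g, [fset act g d | d in Delta] = Delta.

(** Up to one common sign, the coefficient of d in the trace is the sum of the c(g^-1 d) >= 0. If
    the trace were 0, independence of Delta would kill these sums; the term g = 1 then gives c(d) =
    0, hence b = 0. *)
Lemma trace_root b : b \in Phi -> trace b != 0.
Proof.
move=> bP; have [D [[_ indep gen] Dst]] := simpleP.
have [c bE] := gen b bP; apply/eqP => tb0.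
have {tb0} : trace (\sum_(d <- D) d *+ c d) = 0.
  case: bE tb0 => -> //; rewrite raddfN => /eqP; by rewrite oppr_eq0 => /eqP.
have -> : trace (\sum_(d <- D) d *+ c d) =
    \sum_(d <- D) d *~ \sum_g (c (act g^-1%g d))%:Z.
  transitivity (\sum_g \sum_(d <- D) d *+ c (act g^-1%g d)).
    apply: eq_bigr => g _; rewrite raddf_sum -[in RHS](Dst g) big_imfset /=.
      by apply: eq_bigr => d _; rewrite raddfMn actK.
    by move=> x y _ _; exact: act_inj.
  rewrite exchange_big /=; apply: eq_bigr => d _.
  by rewrite mulrz_sumr; apply: eq_bigr => g _; rewrite -pmulrn.
move=> /indep c0; have c0' d : d \in D -> c d = 0%N.
  move=> /c0/eqP; rewrite psumr_eq0 // => /allP/(_ 1%g).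
  by rewrite mem_index_enum invg1 act1 => /(_ isT)/eqP[].
have b0 : b = 0.
  by case: bE => ->; rewrite big_seq big1 ?oppr0 // => d /c0' ->; rewrite mulr0n.
by have := root_neq0 bP; rewrite b0 eqxx.
Qed.

(** As (trace c, trace b) > 0, some (g c, b) is positive. If g c and b differed, g c - b would be a
    root of trace 0. *)
Lemma trace_eq_orbit b c : b \in Phi -> c \in Phi -> trace b = trace c ->
  b \in orbit_of act c.
Proof.
move=> bP cP bc.
have tP : int_span Phi (trace c).
  rewrite /trace; elim/big_ind: _ => [|x y|g _].
  - exact: int_span0.
  - exact: int_spanD.
  - by apply: int_span_mem; exact: act_root.
have: 0 < form (trace c) b.
  rewrite -(pmulrn_lgt0 _ (card_finGroup_gt0 gT)).
  by rewrite -form_trace bc form_gt0 ?trace_root.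
rewrite -formlE raddf_sum => pos.
have [g gP] : exists g, 0 < form (act g c) b.
  apply: contrapT => no; move: pos; rewrite ltNge => /negP[]; apply: sumr_le0 => g _.
  by rewrite leNgt; apply/negP => gP; apply: no; exists g.
apply/orbitP; exists g; apply/eqP; rewrite eq_sym.
apply/negP => /negP gcb.
have := root_sub (act_root g cP) bP gcb.
rewrite pairing_gt0 // => /(_ gP)/trace_root.
by rewrite raddfB /= trace_act bc subrr eqxx.
Qed.
(** * Folding an orbit *)

Section Orbit.
Variable b : X.
Hypothesis bP : b \in Phi.
Local Notation O := (orbit_of act b).

Let OP t : t \in O -> t \in Phi. Proof. exact: orbit_root. Qed.

(** A positive pairing would make t - u a root of trace 0. As t and u have equal length and t + u is
    nonzero, 2 + <t, u^vee> > 0. *)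
Lemma orbit_pairing t u : t \in O -> u \in O -> t != u ->
  pairing t (coroot u) = 0 \/ pairing t (coroot u) = - 1.
Proof.
move=> tO uO tu.
have tP := OP tO; have uP := OP uO.
have le0 : pairing t (coroot u) <= 0.
  rewrite leNgt; apply/negP => /(root_sub tP uP tu)/trace_root.
  by rewrite raddfB /= (orbit_trace tO) (orbit_trace uO) subrr eqxx.
have tu0 : t + u != 0.
  apply/eqP => /(congr1 trace)/eqP; rewrite raddfD raddf0 /=.
  rewrite (orbit_trace tO) (orbit_trace uO) -mulr2n => /eqP/tfX/eqP.
  by rewrite (negPf (trace_root bP)).
have : 0 < form (t + u) (t + u).
  by rewrite form_gt0 //; apply: int_spanD; exact: int_span_mem.
rewrite formDl !formDr [form u t]formC; have := form_coroot t uP.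
rewrite (orbit_form tO) (orbit_form uO).
by have := form_root_gt0 bP; nia.
Qed.

Lemma orbit_pairingC t u : t \in O -> u \in O ->
  pairing t (coroot u) = pairing u (coroot t).
Proof.
move=> tO uO; apply: (mulIf (lt0r_neq0 (form_root_gt0 bP))).
rewrite -{1}(orbit_form uO) -(orbit_form tO) !form_coroot ?OP //.
by rewrite formC.
Qed.

Let q := \sum_(t <- O) pairing t (coroot b).

Lemma orbit_sum u : u \in O -> \sum_(t <- O) pairing t (coroot u) = q.
Proof.
move=> /orbitP[g ->]; rewrite coroot_act // -(orbit_image b g) big_imfset /=.
  by apply: eq_bigr => t _; rewrite pair_act.
by move=> x y _ _; exact: act_inj.
Qed.

(* q |O| (b, b) = 2 (S, S) for the orbit sum S, which is not 0.               *)
Lemma orbit_sum_gt0 : 0 < q.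
Proof.
pose S := \sum_(t <- O) t.
have O0 : (0 < #|` O|)%N.
  by rewrite cardfs_gt0; apply/fset0Pn; exists b; exact: orbit_refl.
have S0 : S != 0.
  apply/eqP => /(congr1 trace)/eqP; rewrite raddf0 raddf_sum.
  rewrite (eq_big_seq (fun=> trace b)) => [|t]; last exact: orbit_trace.
  rewrite sumr_const_fset -(prednK O0) => /eqP/tfX/eqP.
  by rewrite (negPf (trace_root bP)).
have: 0 < 2 * form S S.
  rewrite mulr_gt0 // form_gt0 //; apply: int_span_sum => t tO.
  by apply: int_span_mem; exact: OP.
have -> : 2 * form S S = q * form b b *+ #|` O|.
  rewrite -formlE raddf_sum mulr_sumr -sumr_const_fset.
  apply: eq_big_seq => u uO.
  rewrite formlE formC -form_coroot ?OP // (orbit_form uO); congr (_ * _).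
  by rewrite -pairlE raddf_sum orbit_sum.
by rewrite pmulrn_lgt0 // pmulr_lgt0 // form_root_gt0.
Qed.

Definition adj t u := [&& t \in O, u \in O, t != u & pairing t (coroot u) != 0].

Lemma adj_sym t u : adj t u -> adj u t.
Proof.
by move=> /and4P[tO uO tu p]; rewrite /adj tO uO eq_sym tu orbit_pairingC.
Qed.

Lemma adjE t u : adj t u -> pairing t (coroot u) = - 1.
Proof. by move=> /and4P[tO uO tu /eqP p]; case: (orbit_pairing tO uO tu). Qed.

Lemma not_adj t u : t \in O -> u \in O -> t != u -> ~~ adj t u ->
  pairing t (coroot u) = 0.
Proof. by move=> tO uO tu; rewrite /adj tO uO tu negbK => /eqP. Qed.

Lemma orbit_sumE u : u \in O -> q = 2 + \sum_(t <- O | t != u) pairing t (coroot u).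
Proof.
by move=> uO; rewrite -(orbit_sum uO) (bigD1_fset _ uO) (rd_pair2 rdP) ?OP.
Qed.

Lemma adj_sumE t u : adj t u ->
  q = 1 + \sum_(s <- O | (s != u) && (s != t)) pairing s (coroot u).
Proof.
move=> tu; have /and4P[tO uO t_u _] := tu.
by rewrite (orbit_sumE uO) (bigD1_fset_cond _ tO) // (adjE tu) addrA.
Qed.

Lemma orbit_pairing_le0 t u : t \in O -> u \in O -> t != u ->
  pairing t (coroot u) <= 0.
Proof. by move=> tO uO /(orbit_pairing tO uO)[] ->. Qed.

(** In the sum q at u, the root u contributes 2, t contributes - 1, and the others at most 0; but q
    > 0. *)
Lemma adj_sum1 t u : adj t u -> q = 1.
Proof.
move=> tu; have /and4P[tO uO t_u _] := tu.
suff : q <= 1 by have := orbit_sum_gt0; lia.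
rewrite (adj_sumE tu) gerDl big_seq_cond; apply: sumr_le0 => s.
by move=> /andP[sO /andP[su _]]; exact: orbit_pairing_le0.
Qed.

(** A second neighbour of u would bring q down to 0 or less. *)
Lemma adj_uniq s t u : adj s u -> adj t u -> s = t.
Proof.
move=> su tu; apply/eqP/negP => /negP st.
have /and4P[sO uO s_u _] := su.
have := adj_sum1 tu; rewrite (adj_sumE tu) (bigD1_fset_cond _ sO) ?s_u ?st //.
rewrite (adjE su).
have : \sum_(i <- O | (i != u) && (i != t) && (i != s)) pairing i (coroot u) <= 0.
  rewrite big_seq_cond; apply: sumr_le0 => i.
  by move=> /andP[iO /andP[/andP[iu _] _]]; exact: orbit_pairing_le0.
by move=> /[swap]; rewrite addrA subrr add0r => ->.
Qed.

(** Without a neighbour the sum at u would be 2. As q is constant on the orbit, one adjacent pair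
    forces the whole orbit to be paired off. *)
Lemma adj_exists u : q = 1 -> u \in O -> exists t, adj t u.
Proof.
move=> q1 uO; apply: contrapT => no; move: q1; rewrite (orbit_sumE uO).
rewrite big_seq_cond big1 // => t /andP[tO tu].
by apply: not_adj => //; apply/negP => atu; apply: no; exists t.
Qed.

Lemma adj_form t u : adj t u -> form (t + u) (t + u) = form b b.
Proof.
move=> tu; have /and4P[tO uO _ _] := tu.
have := form_coroot t (OP uO); rewrite (adjE tu) (orbit_form uO).
rewrite formDl !formDr [form u t]formC (orbit_form tO) (orbit_form uO).
by lia.
Qed.

Lemma adj_root t u : adj t u -> t + u \in Phi.
Proof.
move=> tu; have /and4P[tO uO _ _] := tu.
have := root_reflection (OP uO) (OP tO).
by rewrite /reflection pairlE (adjE tu) mulrNz opprK mulr1z.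
Qed.

(** A coroot is given by 2 (x, r) / (r, r), and t, u, t + u have the same length. *)
Lemma adj_coroot t u x : adj t u ->
  pairing x (coroot (t + u)) = pairing x (coroot t) + pairing x (coroot u).
Proof.
move=> tu; have /and4P[tO uO _ _] := tu.
apply: (mulIf (lt0r_neq0 (form_root_gt0 bP))).
rewrite -{1}(adj_form tu) form_coroot ?adj_root // formDr [RHS]mulrDl.
rewrite -{1}(orbit_form tO) -(orbit_form uO) !form_coroot ?OP //.
by rewrite mulrDr.
Qed.

Lemma adj_pairing s t u : s \in O -> adj t u ->
  pairing s (coroot (t + u)) = ((s == t) || (s == u))%:R.
Proof.
move=> sO tu; rewrite (adj_coroot _ tu).
have /and4P[tO uO t_u _] := tu.
have [->|st] := eqVneq s t; first by rewrite (adjE tu) (rd_pair2 rdP) ?OP.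
have [->|su] := eqVneq s u.
  by rewrite (adjE (adj_sym tu)) (rd_pair2 rdP) ?OP.
rewrite !not_adj //; apply/negP => /adj_sym h.
  by case/eqP: st; apply: adj_uniq (adj_sym h) tu.
by case/eqP: su; apply: adj_uniq (adj_sym h) (adj_sym tu).
Qed.

Lemma orthogonal_setPn : ~~ orthogonal_set pairing coroot O ->
  exists t u, adj t u.
Proof.
move=> /allPn[t tO /allPn[u uO]]; rewrite negb_or => /andP[tu o].
by exists t, u; rewrite /adj tO uO tu.
Qed.

Local Notation XiO := (Xi pairing coroot act b).

Lemma Xi_adjP x : ~~ orthogonal_set pairing coroot O ->
  reflect (exists t u, adj t u /\ x = t + u) (x \in XiO).
Proof.
move=> no; rewrite /Xi (negPf no); apply: (iffP (imfset2P _ _ _ _ _)).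
  move=> [t tO [u]]; rewrite !inE /= => /and3P[uO ut tu] ->.
  by exists t, u; split=> //; rewrite /adj tO uO eq_sym ut.
move=> [t [u [/and4P[tO uO tu p] ->]]]; exists t => //; exists u => //.
by rewrite !inE /= uO eq_sym tu.
Qed.

Lemma adj_add_eq s t s' t' : adj s t -> adj s' t' ->
  s' \in [:: s; t] -> s' + t' = s + t.
Proof.
move=> st st'; rewrite !inE => /orP[]/eqP e; subst s'.
  by rewrite (adj_uniq (adj_sym st') (adj_sym st)).
by rewrite (adj_uniq (adj_sym st') st) addrC.
Qed.

(** Only the pair sum that involves s contributes. *)
Lemma Xi_pairing_sum s : ~~ orthogonal_set pairing coroot O -> s \in O ->
  \sum_(x <- XiO) pairing s (coroot x) = 1.
Proof.
move=> no sO; have [t0 [u0 tu0]] := orthogonal_setPn no.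
have [t ts] := adj_exists (adj_sum1 tu0) sO.
have xi : t + s \in XiO by apply/Xi_adjP => //; exists t, s.
rewrite (bigD1_fset _ xi) adj_pairing // eqxx orbT big_seq_cond big1 ?addr0 //.
move=> x /andP[/Xi_adjP-/(_ no)[u [v [uv ->]]] ne].
rewrite adj_pairing //; case: (boolP (_ || _)) => // h; case/eqP: ne.
by rewrite [RHS]addrC; apply/esym/(adj_add_eq uv (adj_sym ts)); rewrite !inE.
Qed.

(** Double counting of the <s, x^vee>: each s contributes 1, and each x = t + u contributes 2 q =
    2. *)
Lemma card_Xi_double : ~~ orthogonal_set pairing coroot O ->
  #|` O| = (2 * #|` XiO|)%N.
Proof.
move=> no; have [t0 [u0 tu0]] := orthogonal_setPn no.
have e : \sum_(s <- O) \sum_(x <- XiO) pairing s (coroot x) = 1 *+ #|` O|.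
  rewrite -sumr_const_fset; apply: eq_big_seq => s sO; exact: Xi_pairing_sum.
have : \sum_(x <- XiO) \sum_(s <- O) pairing s (coroot x) = 2 *+ #|` XiO|.
  rewrite -sumr_const_fset; apply: eq_big_seq => x /Xi_adjP-/(_ no)[t [u [tu ->]]].
  under eq_bigr do rewrite (adj_coroot _ tu).
  have /and4P[tO uO _ _] := tu.
  by rewrite big_split /= !orbit_sum // (adj_sum1 tu0).
rewrite exchange_big e; lia.
Qed.

Definition fold_mult := (#|` O| %/ #|` XiO|)%N.

Lemma fold_mult_orth : orthogonal_set pairing coroot O -> fold_mult = 1%N.
Proof.
move=> o; rewrite /fold_mult /Xi o divnn cardfs_gt0.
by have -> : O != fset0 by apply/fset0Pn; exists b; exact: orbit_refl.
Qed.

Lemma fold_mult_nonorth : ~~ orthogonal_set pairing coroot O -> fold_mult = 2%N.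
Proof.
move=> no; rewrite /fold_mult (card_Xi_double no) mulnK // cardfs_gt0.
have [t [u tu]] := orthogonal_setPn no.
by apply/fset0Pn; exists (t + u); apply/Xi_adjP => //; exists t, u.
Qed.

Lemma Xi_root x : x \in XiO -> x \in Phi.
Proof.
have [o|no] := boolP (orthogonal_set pairing coroot O).
  by rewrite /Xi o; exact: OP.
by move=> /Xi_adjP-/(_ no)[t [u [tu ->]]]; exact: adj_root.
Qed.

Lemma Xi_trace x : x \in XiO -> trace x = trace b *+ fold_mult.
Proof.
have [o|no] := boolP (orthogonal_set pairing coroot O).
  by rewrite fold_mult_orth // /Xi o; exact: orbit_trace.
rewrite fold_mult_nonorth //.
move=> /Xi_adjP-/(_ no)[t [u [/and4P[tO uO _ _] ->]]].
by rewrite raddfD /= (orbit_trace tO) (orbit_trace uO).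
Qed.

Lemma Xi_orthogonal :
  {in XiO &, forall x y, x != y -> pairing x (coroot y) = 0}.
Proof.
have [o|no] := boolP (orthogonal_set pairing coroot O).
  rewrite /Xi o => x y xO yO xy; move/allP: o => /(_ _ xO)/allP/(_ _ yO).
  by rewrite (negPf xy) => /eqP.
move=> x y /Xi_adjP-/(_ no)[s [t [st ->]]] /Xi_adjP-/(_ no)[u [v [uv ->]]] ne.
have /and4P[sO tO _ _] := st.
rewrite -pairlE raddfD !pairlE !adj_pairing //.
have h s' t' : adj s' t' -> s' + t' = s + t -> ((s' == u) || (s' == v)) = false.
  move=> st' e; apply/negP => h; case/eqP: ne; rewrite -e.
  by apply: adj_add_eq => //; rewrite !inE.
by rewrite (h s t) // (h t s) ?(adj_sym st) 1?addrC // addr0.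
Qed.

Lemma Xi_pairing_root :
  (\sum_(x <- XiO) pairing b (coroot x)) *+ fold_mult = 2.
Proof.
have bO := orbit_refl b.
have [o|no] := boolP (orthogonal_set pairing coroot O); last first.
  by rewrite fold_mult_nonorth // Xi_pairing_sum.
rewrite fold_mult_orth // /Xi o (bigD1_fset _ bO) (rd_pair2 rdP) //.
rewrite big_seq_cond big1 // => t /andP[tO tb].
move/allP: o => /(_ _ bO)/allP/(_ _ tO).
by rewrite eq_sym (negPf tb) => /eqP.
Qed.

End Orbit.

(** * The folded datum *)

Local Notation barX := (barX act).
Local Notation barY := (barY actv).
Local Notation istar := (istar act).
Local Notation barPhi := (barPhi Phi act).
Local Notation bar_val := (bar_coroot_val pairing coroot act).

Fact istar_zmod : zmod_morphism istar.
Proof.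
by move=> x y; apply: val_inj; rewrite /= /istarQ raddfB /coinv linearB.
Qed.
HB.instance Definition _ := GRing.isZmodMorphism.Build X barX istar istar_zmod.

Lemma istar_surj (u : barX) : exists x, istar x = u.
Proof. by case: u => u uP; have /asboolP[x xE] := uP; exists x; apply: val_inj. Qed.

Lemma sum_actQ x : \sum_g actQ act g (toQ x) = toQ (trace x).
Proof. by rewrite raddf_sum; apply: eq_bigr => g _; exact: tensQ_mapE. Qed.

Lemma coinv_emb_istar x :
  coinv_emb (val (istar x)) = #|gT|%:R^-1 *: toQ (trace x).
Proof.
rewrite -sum_actQ; apply: coinv_embE => g h; elim/tensQW => y n.
by rewrite /actQ /= !tensQ_mapE (autg_mul autP).
Qed.

Lemma card_neq0 : #|gT|%:R != 0 :> rat.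
Proof. by rewrite pnatr_eq0 -lt0n card_finGroup_gt0. Qed.

Lemma toQ_inj : injective (@toQ X).
Proof.
move=> x y /eq_frac[[//|k] _]; rewrite !mulr1n => /eqP.
by rewrite -subr_eq0 -mulrnBl => /eqP/tfX/eqP; rewrite subr_eq0 => /eqP.
Qed.

(** Forward: [coinv_emb] sends the class of x to trace x / |Gamma|, and X embeds in its rational
    extension. *)
Lemma istar_eq x y : istar x = istar y <-> trace x = trace y.
Proof.
split=> [e|e].
  apply: toQ_inj; have := coinv_emb_istar x.
  by rewrite e coinv_emb_istar => /(scalerI (invr_neq0 card_neq0)).
apply: val_inj; apply/toquotP; rewrite -raddfB; apply/asboolP.
(* For v of trace 0 and w = - v / |Gamma|, the g w sum to 0, so the g w - w sum to v. *)
exists (fun=> - #|gT|%:R^-1 *: toQ (x - y)).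
rewrite sumrB (eq_bigr (fun g => - #|gT|%:R^-1 *: actQ act g (toQ (x - y)))).
  rewrite -scaler_sumr sum_actQ (_ : trace (x - y) = 0) ?raddf0 ?scaler0 ?add0r;
    last first.
    by rewrite raddfB /= e subrr.
  rewrite sumr_const scaleNr mulNrn opprK.
  by rewrite -scaler_nat scalerA mulfV ?card_neq0 // scale1r.
by move=> g _; rewrite linearZ.
Qed.

Lemma pair_invariant x (l : barY) g : pairing (act g x) (val l) = pairing x (val l).
Proof.
by have /forallP/(_ g)/eqP {1}<- := valP l; rewrite pair_act.
Qed.

Lemma pair_trace x (l : barY) :
  pairing (trace x) (val l) = pairing x (val l) *+ #|gT|.
Proof.
rewrite -pairlE raddf_sum -sumr_const; apply: eq_bigr => g _.
by rewrite pairlE pair_invariant.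
Qed.

Definition bar_pairing (u : barX) (l : barY) : int :=
  pairing (sval (cid (istar_surj u))) (val l).

(** The choice of lift does not matter, since <trace x, l> = |Gamma| <x, l> for invariant l. *)
Lemma bar_pairingE x l : bar_pairing (istar x) l = pairing x (val l).
Proof.
rewrite /bar_pairing; case: cid => y /= /istar_eq e.
have G0 : #|gT| = #|gT|.-1.+1 by rewrite prednK // card_finGroup_gt0.
have := congr1 (pairing^~ (val l)) e; rewrite !pair_trace G0.
by move=> /pmulrnI; apply.
Qed.

Lemma bar_pairingP : is_bar_pairing pairing bar_pairing.
Proof.
move=> u l; have [x <-] := istar_surj u.
rewrite bar_pairingE coinv_emb_istar.
rewrite [_ *: _]tensQ_scaleE (tensQ_evalE (pairl (val l))).
rewrite raddfMz /= pair_trace mulrzz muln1.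
have [d dE] : exists d, `|denq #|gT|%:R^-1|%N = d.+1.
  by exists `|denq (#|gT|%:R^-1 : rat)|%N.-1; rewrite prednK // absz_gt0 denq_neq0.
have nE := numqE (#|gT|%:R^-1 : rat).
rewrite dE /= rmorphM /= nE -absz_denq dE.
rewrite rmorphMn /= -mulr_natr -pmulrn mulrA mulfK ?pnatr_eq0 //.
by rewrite mulfK ?card_neq0.
Qed.

(** * Invariants in Y and perfectness of the folded pairing *)

Definition traceY y := \sum_g actv g y.

Lemma pair_traceY x y : pairing x (traceY y) = pairing (trace x) y.
Proof.
rewrite -pairrE -pairlE !raddf_sum (reindex_inj invg_inj).
by apply: eq_bigr => g _; rewrite pairrE pairlE pair_actv invgK.
Qed.

Lemma actv_traceY g y : actv g (traceY y) = traceY y.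
Proof.
rewrite [RHS](reindex_inj (mulgI g)) raddf_sum.
by apply: eq_bigr => h _; rewrite actvM.
Qed.

Lemma traceY_invariant y : traceY y \in Defs.invariant actv.
Proof. by apply/forallP => g; rewrite actv_traceY. Qed.

(** This endomorphism has the invariants as its kernel, so that [kernel_summand] applies to them. *)
Fact fixed_defect_zmod : zmod_morphism (fun y => y *+ #|gT| - traceY y).
Proof.
move=> y z; have TB : traceY (y - z) = traceY y - traceY z.
  by rewrite -sumrB; apply: eq_bigr => g _; rewrite raddfB.
rewrite TB mulrnBl !opprB [traceY z - traceY y]addrC addrACA.
by rewrite [- _ + traceY z]addrC.
Qed.

Lemma invariantP y :
  reflect (mk_additive fixed_defect_zmod y = 0) (y \in Defs.invariant actv).
Proof.
apply: (iffP forallP) => [h|h g]; rewrite /mk_additive /GRing.Additive.sort /=.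
  apply/eqP; rewrite subr_eq0 -sumr_const; apply/eqP/eq_bigr => g _.
  by rewrite (eqP (h g)).
move: h => /= /eqP; rewrite subr_eq0 => /eqP h.
have G0 : #|gT| = #|gT|.-1.+1 by rewrite prednK // card_finGroup_gt0.
rewrite -subr_eq0; apply/eqP; apply: (tfY (n := #|gT|.-1)).
by rewrite -G0 mulrnBl -raddfMn h actv_traceY subrr.
Qed.

(** The coordinates [c i] are defined on all of Y, so functionals on the invariants extend to Y. *)
Lemma bar_basis : exists r (e : 'I_r -> barY) (c : 'I_r -> {additive Y -> int}),
  (forall i j, c i (val (e j)) = (i == j)%:R) /\
  forall l : barY, l = \sum_i e i *~ c i (val l).
Proof.
have [r [e [c [e0 ce ek]]]] :=
  kernel_summand (mk_additive fixed_defect_zmod) (rd_freeY rdP).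
pose eb i : barY := exist _ (e i) (introT (invariantP (e i)) (e0 i)).
exists r, eb, c; split=> // l; apply: val_inj.
rewrite raddf_sum {1}(ek (val l) (elimT (invariantP _) (valP l))).
by apply: eq_bigr => i _; rewrite raddfMz.
Qed.

Lemma barY_free : free_of_finite_rank barY.
Proof.
have [r [e [c [ce ek]]]] := bar_basis; exists r, e => l.
exists [ffun i => c i (val l)]; split.
  by rewrite {1}[l]ek; apply: eq_bigr => i _; rewrite ffunE.
have cM i j n : c i (sval (e j *~ n)) = (i == j)%:R * n.
  by rewrite -[sval _]/(val (e j *~ n)) !raddfMz ce mulrzz.
move=> d ->; apply/ffunP => i; rewrite ffunE !raddf_sum (bigD1 i) //= big1 ?addr0.
  by rewrite cM eqxx mul1r.
by move=> j ji; rewrite cM eq_sym (negPf ji) mul0r.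
Qed.

Lemma bar_pairing_perfect : perfect_pairing bar_pairing.
Proof.
split.
- move=> l u u'; have [x <-] := istar_surj u; have [x' <-] := istar_surj u'.
  by rewrite -raddfD !bar_pairingE -!pairlE raddfD.
- move=> u l l'; have [x <-] := istar_surj u.
  by rewrite !bar_pairingE -!pairrE !raddfD.
- move=> f; have [r [e [c [_ ek]]]] := bar_basis.
  (* The extension of [f] to Y through the coordinates is represented by an element of X. *)
  have FB : zmod_morphism (fun y => \sum_i f (e i) * c i y).
    by move=> y z; rewrite -sumrB; apply: eq_bigr => i _; rewrite raddfB mulrBr.
  have [x [xE _]] := pair_perfectl root_datum_perfect (mk_additive FB).
  exists (istar x); split=> [l|u uE].
    rewrite bar_pairingE xE {2}[l]ek raddf_sum; apply: eq_bigr => i _.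
    by rewrite raddfMz mulrzz.
  have [x' x'E] := istar_surj u; rewrite -x'E; apply/istar_eq.
  apply: (pairing_injl root_datum_perfect) => y.
  (* Uniqueness: pairing trace z with y amounts to pairing z with the invariant element
     [traceY y]. *)
  pose ty : barY := exist _ (traceY y) (traceY_invariant y).
  have E z : pairing (trace z) y = bar_pairing (istar z) ty.
    by rewrite bar_pairingE -pair_traceY.
  rewrite !E x'E uE bar_pairingE xE [in RHS](ek ty) [RHS]raddf_sum.
  by apply: eq_bigr => i _; rewrite raddfMz mulrzz.
- move=> f.
  have fB : zmod_morphism (f \o istar) by move=> x x'; rewrite /= !raddfB.
  have [y [yE yU]] := pair_perfectr root_datum_perfect (mk_additive fB).
  (* Since [f \o istar] does not see the action, uniqueness of y makes y invariant. *)
  have yI : y \in Defs.invariant actv.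
    apply/forallP => g; apply/eqP/esym/yU => x.
    by rewrite pair_actv yE /=; congr (f _); apply/istar_eq; exact: trace_act.
  pose l0 : barY := exist _ y yI; exists l0; split=> [u|l lE].
    by have [x <-] := istar_surj u; rewrite bar_pairingE yE.
  by apply: val_inj; apply: yU => x; rewrite -bar_pairingE lE.
Qed.

Local Notation bpl := (left_pairing bar_pairing_perfect).
Local Notation bpr := (right_pairing bar_pairing_perfect).

Lemma barX_free : free_of_finite_rank barX.
Proof. exact: perfect_pairing_free bar_pairing_perfect barY_free. Qed.

Let tf_barX : torsion_free barX := free_torsion_free barX_free.

(** * Folded coroots and reflections *)

Lemma bar_val_invariant b : b \in Phi -> bar_val b \in Defs.invariant actv.
Proof.
move=> bP; apply/forallP => g; apply/eqP; rewrite raddfMn raddf_sum.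
congr (_ *+ _); have XiE : [fset act g x | x in Xi pairing coroot act b] =
    Xi pairing coroot act b.
  apply/fsetP => x; apply/imfsetP/idP => [[z zi ->]|xi]; first exact: Xi_act.
  by exists (act g^-1%g x); [exact: Xi_act|rewrite actVK].
rewrite -[in RHS]XiE big_imfset /=; last by move=> x y _ _; exact: act_inj.
by apply: eq_big_seq => x /(Xi_root bP) xP; rewrite coroot_act.
Qed.

(** The first root above u serves as preimage; the defaults 0 of [head] and [insubd] are reached
    only outside [barPhi]. *)
Definition bar_coroot (u : barX) : barY :=
  insubd 0 (bar_val (head 0 [seq b <- Phi | istar b == u])).

Lemma bar_corootP : is_bar_coroot pairing Phi coroot bar_coroot.
Proof.
move=> b bP; rewrite /bar_coroot.
set s := [seq _ <- _ | _]; have bs : b \in s by rewrite mem_filter eqxx.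
have : head 0 s \in s by case: s bs => // a s _; rewrite mem_head.
rewrite mem_filter => /andP[/eqP/istar_eq e cP].
rewrite val_insubd bar_val_invariant //; apply: bar_coroot_val_orbit.
exact: trace_eq_orbit.
Qed.

Lemma bar_pair_coroot x b : b \in Phi ->
  bar_pairing (istar x) (bar_coroot (istar b)) =
  (\sum_(y <- Xi pairing coroot act b) pairing x (coroot y)) *+ fold_mult b.
Proof.
by move=> bP; rewrite bar_pairingE bar_corootP // -pairrE raddfMn raddf_sum.
Qed.

Lemma barPhiP u : reflect (exists2 b, b \in Phi & u = istar b) (u \in barPhi).
Proof. by apply: (iffP (imfsetP _ _ _ _)) => [[b bP ->]|[b bP ->]]; exists b. Qed.

Lemma bar_pair2 : {in barPhi, forall u, bar_pairing u (bar_coroot u) = 2}.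
Proof.
by move=> _ /barPhiP[b bP ->]; rewrite bar_pair_coroot // Xi_pairing_root.
Qed.

(* The reflection in istar b is induced by the product of the commuting       *)
(* reflections in the roots of Xi b.                                          *)
Lemma bar_root_reflection u v : u \in barPhi -> v \in barPhi ->
  reflection u (bpl (bar_coroot u)) v \in barPhi.
Proof.
move=> /barPhiP[b bP ->] /barPhiP[c cP ->]; apply/barPhiP.
exists (c - \sum_(x <- Xi pairing coroot act b) x *~ pairing c (coroot x)).
  apply: orthogonal_reflections => //; first exact: fset_uniq.
  - by move=> x; exact: Xi_root.
  - exact: Xi_orthogonal.
rewrite /reflection -[left_pairing _ _ _]/(bar_pairing _ _) bar_pair_coroot //.
rewrite -raddfMz -raddfB; apply/istar_eq; rewrite raddfB [RHS]raddfB.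
(* Up to trace, each x in [Xi] counts as [fold_mult b] copies of b, which absorbs the factor in the
   folded coroot. *)
congr (_ - _); rewrite raddfMz raddf_sum -sumrMnl mulrz_sumr.
apply: eq_big_seq => x xXi; rewrite raddfMz /= (Xi_trace bP xXi) pmulrn -mulrzA.
by congr (_ *~ _); rewrite mulrC -mulr_natr natz.
Qed.

(** The left side pairs to 2 with the reflected root [w], and the reflection it defines is s_u s_v
    s_u. By [reflection_functional_uniq] it agrees with the coroot of [w] on [barPhi]; both lie in
    the span of the coroots, where the values on roots decide. *)
Lemma bar_coreflection u v : u \in barPhi -> v \in barPhi ->
  reflection (bar_coroot u) (bpr u) (bar_coroot v) =
  bar_coroot (reflection u (bpl (bar_coroot u)) v).
Proof.
move=> uP vP.
have ru := bar_root_reflection uP vP; set w := reflection u _ v in ru *.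
set y := reflection (bar_coroot u) _ _.
have yE x : bar_pairing x y =
    bar_pairing (reflection u (bpl (bar_coroot u)) x) (bar_coroot v).
  by rewrite pairing_reflection.
have inv := @reflectionK _ u (bpl (bar_coroot u)) (bar_pair2 uP).
have eq_on : {in barPhi, bpl y =1 bpl (bar_coroot w)}.
  apply: (@reflection_functional_uniq _ barPhi w) => //.
  - by rewrite -[left_pairing _ _ _]/(bar_pairing _ _) yE inv bar_pair2.
  - exact: bar_pair2.
  - move=> x xP; rewrite /reflection -[left_pairing _ _ _]/(bar_pairing _ _) yE.
    rewrite -[x in x - _]inv /w -raddfMz -raddfB.
    by apply/bar_root_reflection/bar_root_reflection/bar_root_reflection.
  - by move=> x xP; exact: bar_root_reflection.
have val_span z : z \in barPhi -> int_span Phiv (val (bar_coroot z)).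
  move=> /barPhiP[b bP ->]; rewrite bar_corootP // /bar_coroot_val pmulrn.
  apply/int_spanMz/int_span_sum => x /Xi_root xP.
  by apply: int_span_mem; apply: coroot_Phiv; exact: xP.
apply: val_inj; apply/eqP; rewrite -subr_eq0; apply/eqP/coroot_span_eq0.
  apply: int_spanB; last exact: val_span.
  rewrite /y /reflection raddfB raddfMz /=.
  by apply: int_spanB; last apply: int_spanMz; exact: val_span.
move=> a aP; rewrite -pairrE raddfB !pairrE -!bar_pairingE.
have /eq_on : istar a \in barPhi by apply/barPhiP; exists a.
by rewrite -![left_pairing _ _ _]/(bar_pairing _ _) => ->; rewrite subrr.
Qed.

Lemma bar_root_datum : is_root_datum bar_pairing barPhi
  [fset bar_coroot a | a in barPhi] bar_coroot.
Proof.
split.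
- exact: barX_free.
- exact: barY_free.
- exact: bar_pairing_perfect.
- move=> u v uP vP uv.
  (* Roots with the same coroot have reflections with the same functional. *)
  apply: (@reflection_root_uniq _ barPhi u v (bpl (bar_coroot u))) => //.
  + exact: bar_pair2.
  + by rewrite uv; exact: bar_pair2.
  + by move=> x; exact: bar_root_reflection.
  + by move=> x; rewrite uv; exact: bar_root_reflection.
- by [].
- exact: bar_pair2.
- move=> u uP; apply: (@reflection_fset _ barPhi u (bpl (bar_coroot u))).
    exact: bar_pair2.
  by move=> x; exact: bar_root_reflection.
- move=> u uP; apply: (@reflection_fset _ _ (bar_coroot u) (bpr u)).
    exact: bar_pair2.
  move=> _ /imfsetP[v vP ->]; rewrite bar_coreflection //.
  by apply: in_imfset; exact: bar_root_reflection.
Qed.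

End Folding.
End RootDatumTheory.

Theorem theorem7 (X Y : zmodType) (pairing : X -> Y -> int)
    (Phi : {fset X}) (Phiv : {fset Y}) (coroot : X -> Y)
    (gT : finGroupType)
    (act : gT -> {additive X -> X}) (actv : gT -> {additive Y -> Y})
    (rdP : is_root_datum pairing Phi Phiv coroot)
    (autP : is_aut_group pairing Phi coroot act actv)
    (simpleP : exists Delta : {fset X}, is_simple_roots Phi Delta /\
       forall g, [fset act g d | d in Delta] = Delta) :
  exists (barpair : barX act -> barY actv -> int)
         (barcoroot : barX act -> barY actv),
    [/\ is_bar_pairing pairing barpair,
        is_bar_coroot pairing Phi coroot barcoroot &
        is_root_datum barpair (barPhi Phi act)
          [fset barcoroot a | a in barPhi Phi act] barcoroot].
Proof.
exists (@bar_pairing X Y pairing gT act actv).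
exists (@bar_coroot X Y pairing Phi coroot gT act actv).
split.
- exact (bar_pairingP rdP autP).
- exact (bar_corootP rdP autP simpleP).
- exact (bar_root_datum rdP autP simpleP).
Qed.
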